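(* Let $X$ be a connected finite polyhedron which is a smooth manifold of dimension at least $3$, and let $n\ge1$. Then $\pi_1(D_n(X))=B_n(X)$ is isomorphic to $\pi_1(X)^n\rtimes\Sigma_n$.
   Context: $D_n(X)$ is the set of $n$-element subsets of $X$, topologized as the quotient by the symmetric group $\Sigma_n$ of $F_n(X)=\{(x_1,\dots,x_n)\in X^n\mid x_i\ne x_j\text{ for }i\neq j\}\subseteq X^n$. Its fundamental group $B_n(X)=\pi_1(D_n(X))$ is the full braid group of $X$. The semidirect product $\pi_1(X)^n\rtimes\Sigma_n$ is formed with $\Sigma_n$ permuting the factors of the $n$-fold direct product $\pi_1(X)^n$: $(\alpha_1,\dots,\alpha_n;\sigma)(\beta_1,\dots,\beta_n;\rho)=(\alpha_1\beta_{\sigma^{-1}(1)},\dots,\alpha_n\beta_{\sigma^{-1}(n)};\sigma\circ\rho)$. *)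

(* Defs.v *)
From HB Require Import structures.
From mathcomp Require Import all_boot all_order all_algebra all_fingroup.
From mathcomp Require Import generic_quotient.
From mathcomp Require Import all_classical reals topology normedtype derive.
From mathcomp Require Import homotopy.
From mathcomp Require Import lra.

Set Implicit Arguments.
Unset Strict Implicit.
Unset Printing Implicit Defensive.

Import Order.TTheory GRing.Theory Num.Theory.
Import numFieldNormedType.Exports.

Local Open Scope classical_set_scope.
Local Open Scope ring_scope.
Local Open Scope card_scope.
Local Open Scope quotient_scope.

Definition unit_interval (R : realType) : Type := set_type `[0 : R, 1].

Section UnitInterval.
Context {R : realType}.
Local Notation I := (unit_interval R).

HB.instance Definition _ := Topological.on I.

Fact clamp_subproof (x : R) : Num.min 1 (Num.max 0 x) \in `[0 : R, 1]%classic.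
Proof.
rewrite inE /= in_itv /= le_min ler01 le_max lexx /=.
by rewrite ge_min lexx.
Qed.

Definition clamp (x : R) : I := exist _ (Num.min 1 (Num.max 0 x)) (clamp_subproof x).

Lemma val_clamp (x : R) : 0 <= x <= 1 -> \val (clamp x) = x.
Proof. by case/andP=> x0 x1; rewrite /= max_r // min_r. Qed.

Lemma val_ge0 (t : I) : 0 <= \val t.
Proof. by case: t => t /= /set_mem; rewrite /= in_itv /= => /andP[]. Qed.

Lemma val_le1 (t : I) : \val t <= 1.
Proof. by case: t => t /= /set_mem; rewrite /= in_itv /= => /andP[]. Qed.

Lemma valK_clamp (t : I) : clamp (\val t) = t.
Proof. by apply: val_inj; rewrite val_clamp // val_ge0 val_le1. Qed.

Lemma clamp_le0 (x : R) : x <= 0 -> clamp x = clamp 0.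
Proof. by move=> x0; apply: val_inj; rewrite /= max_l // max_l. Qed.

Lemma clamp_ge1 (x : R) : 1 <= x -> clamp x = clamp 1.
Proof.
move=> x1; apply: val_inj; rewrite /= !max_r ?ler01 ?(le_trans ler01) //.
by rewrite !min_l.
Qed.

Lemma clamp01 : clamp 0 != clamp 1.
Proof.
apply/eqP => /(congr1 val); rewrite !val_clamp ?lexx ?ler01 // => /eqP.
by rewrite eq_sym oner_eq0.
Qed.

HB.instance Definition _ := isBiPointed.Build I clamp01.

Lemma val_zero : \val (zero : I) = 0.
Proof. by rewrite val_clamp // lexx ler01. Qed.

Lemma val_one : \val (one : I) = 1.
Proof. by rewrite val_clamp // lexx ler01. Qed.

Lemma val_continuous : continuous (\val : I -> R).
Proof. exact: (@initial_continuous I R set_val). Qed.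

Lemma clamp_continuous : continuous clamp.
Proof.
apply: (@continuous_comp_initial I R R set_val) => x.
have -> : (set_val \o clamp : R -> R) = (cst 1 : R -> R^o) \min (cst 0 \max id).
  by apply/funext => y; rewrite /= set_valE.
apply: continuous_min; first exact: cst_continuous.
by apply: continuous_max; [exact: cst_continuous|].
Qed.

Lemma continuous_piecewise (T U : topologicalType) (a : T -> R) (c : R)
    (f g : T -> U) :
  continuous a -> continuous f -> continuous g ->
  (forall x, a x = c -> f x = g x) ->
  continuous (fun x => if a x <= c then f x else g x).
Proof.
move=> ca cf cg fg; apply/continuous_subspace_setT.
have -> : [set: T] = a @^-1` [set y | y <= c] `|` a @^-1` [set y | c <= y].
  by apply/seteqP; split=> // x _ /=; have [|/ltW] := leP (a x) c; [left|right].
apply: withinU_continuous.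
- by apply: preimage_closed => [x _|]; [exact: ca|exact: closed_le].
- by apply: preimage_closed => [x _|]; [exact: ca|exact: closed_ge].
- apply: (@subspace_eq_continuous _ _ _ f); last exact: continuous_subspaceT.
  move=> x /set_mem axc; change (f x = if a x <= c then f x else g x).
  by rewrite ifT.
- apply: (@subspace_eq_continuous _ _ _ g); last exact: continuous_subspaceT.
  move=> x /set_mem cax; change (g x = if a x <= c then f x else g x).
  case: ifP => // axc.
  by rewrite fg //; apply/eqP; rewrite eq_le axc cax.
Qed.

End UnitInterval.

Notation loop R x := (@pathType (unit_interval R) _ x x).

Section Homotopy.
Context {R : realType} {T : topologicalType} {x : T}.
Local Notation I := (unit_interval R).
Implicit Types p q r : loop R x.

Definition homotopic_rel p q : Prop :=
  exists H : I * I -> T,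
    [/\ continuous H,
        forall t, H (t, zero) = p t /\ H (t, one) = q t
      & forall s, H (zero, s) = x /\ H (one, s) = x].

Definition homotopic p q : bool := `[< homotopic_rel p q >].

Lemma homotopic_reparam (p : I -> T) (phi psi : I -> R) q0 q1 :
  continuous p -> continuous phi -> continuous psi ->
  phi zero = psi zero -> phi one = psi one ->
  (forall t, q0 t = p (clamp (phi t))) -> (forall t, q1 t = p (clamp (psi t))) ->
  homotopic_rel q0 q1.
Proof.
move=> cp cphi cpsi e0 e1 q0E q1E.
exists (fun ts : I * I => p (clamp ((1 - \val ts.2) * phi ts.1 + \val ts.2 * psi ts.1))).
split.
- have cs : continuous (fun ts : I * I => \val ts.2 : R).
    move=> z; apply: (@continuous_comp _ _ _ snd (\val : I -> R)).
      exact: cvg_snd.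
    exact: val_continuous.
  have c1 f : continuous f -> continuous (fun ts : I * I => f ts.1 : R).
    move=> cf z; apply: (@continuous_comp _ _ _ fst f); last exact: cf.
    exact: cvg_fst.
  move=> z; apply: (@continuous_comp _ _ _ (fun ts : I * I =>
    clamp ((1 - \val ts.2) * phi ts.1 + \val ts.2 * psi ts.1)) p); last exact: cp.
  apply: (@continuous_comp _ _ _ (fun ts : I * I =>
    (1 - \val ts.2) * phi ts.1 + \val ts.2 * psi ts.1) clamp).
    apply: cvgD; apply: cvgM; [|exact: c1|exact: cs|exact: c1].
    by apply: cvgB; [exact: cvg_cst|exact: cs].
  exact: clamp_continuous.
- by move=> t; rewrite q0E q1E val_zero val_one; split; congr (p (clamp _)); lra.
- move=> s /=; split.
    have <- : q1 zero = x by exact: path_zero.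
    rewrite e0 q1E; congr (p (clamp _)); lra.
  have <- : q1 one = x by exact: path_one.
  rewrite e1 q1E; congr (p (clamp _)); lra.
Qed.

Lemma homotopic_refl : reflexive homotopic.
Proof.
move=> p; apply/asboolP.
apply: (@homotopic_reparam p (\val : I -> R) (\val : I -> R)) => //.
- exact: cts_fun.
- exact: val_continuous.
- exact: val_continuous.
- by move=> t; rewrite valK_clamp.
- by move=> t; rewrite valK_clamp.
Qed.

Let pair1E (A B : Type) (a : A) (b : B) : (a, b).1 = a.
Proof. by []. Qed.
Let pair2E (A B : Type) (a : A) (b : B) : (a, b).2 = b.
Proof. by []. Qed.

Lemma continuous_pair_comp (S A B C : topologicalType) (f : A * B -> C)
    (g : S -> A) (h : S -> B) : continuous f -> continuous g -> continuous h ->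
  continuous (fun z => f (g z, h z)).
Proof.
move=> cf cg ch z; apply: (@continuous_comp _ _ _ (fun z => (g z, h z)) f).
  by apply: cvg_pair; [exact: cg|exact: ch].
exact: cf.
Qed.

Lemma continuous_fst (A B : topologicalType) : continuous (@fst A B).
Proof. by move=> z; exact: cvg_fst. Qed.
Lemma continuous_snd (A B : topologicalType) : continuous (@snd A B).
Proof. by move=> z; exact: cvg_snd. Qed.

Lemma continuous_valfst : continuous (fun z : I * I => \val z.1 : R).
Proof.
move=> z; apply: (@continuous_comp _ _ _ fst (\val : I -> R)).
  exact: cvg_fst.
exact: val_continuous.
Qed.
Lemma continuous_valsnd : continuous (fun z : I * I => \val z.2 : R).
Proof.
move=> z; apply: (@continuous_comp _ _ _ snd (\val : I -> R)).
  exact: cvg_snd.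
exact: val_continuous.
Qed.

Lemma continuous_clamp_affine (S : topologicalType) (f : S -> R) (a b : R) :
  continuous f -> continuous (fun z => clamp (a * f z + b)).
Proof.
move=> cf z; apply: (@continuous_comp _ _ _ (fun z => a * f z + b) clamp).
  by apply: cvgD; [apply: cvgMr; exact: cf|exact: cvg_cst].
exact: clamp_continuous.
Qed.

Lemma homotopic_sym : symmetric homotopic.
Proof.
have sym p q : homotopic_rel p q -> homotopic_rel q p.
  move=> [H [cH H01 Hx]]; exists (fun z => H (z.1, clamp (-1 * \val z.2 + 1))).
  split=> [|t|s].
  - apply: continuous_pair_comp => //; first exact: continuous_fst.
    apply: continuous_clamp_affine; exact: continuous_valsnd.
  - cbv beta; rewrite !pair1E !pair2E val_zero val_one mulr0 add0r mulr1 addNr.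
    by have [-> ->] := H01 t.
  - exact: Hx.
by move=> p q; apply/idP/idP => /asboolP/sym/asboolP.
Qed.

Lemma homotopic_trans : transitive homotopic.
Proof.
move=> q p r /asboolP[H [cH H01 Hx]] /asboolP[K [cK K01 Kx]]; apply/asboolP.
exists (fun z => if \val z.2 <= 1 / 2 then H (z.1, clamp (2 * \val z.2 + 0))
                 else K (z.1, clamp (2 * \val z.2 + -1))).
split.
- apply: continuous_piecewise.
  + exact: continuous_valsnd.
  + apply: continuous_pair_comp => //; first exact: continuous_fst.
    apply: continuous_clamp_affine; exact: continuous_valsnd.
  + apply: continuous_pair_comp => //; first exact: continuous_fst.
    apply: continuous_clamp_affine; exact: continuous_valsnd.
  + move=> [t s] /= ->.
    have -> : 2 * (1 / 2) + 0 = 1 :> R by lra.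
    have -> : 2 * (1 / 2) + -1 = 0 :> R by lra.
    by rewrite (H01 t).2 (K01 t).1.
- move=> t; cbv beta; rewrite !pair1E !pair2E val_zero val_one ifT; last by lra.
  rewrite ifF; last by apply/negbTE; lra.
  rewrite mulr0 addr0 (H01 t).1; split=> //.
  have -> : 2 * 1 + -1 = 1 :> R by lra.
  by rewrite (K01 t).2.
- by move=> s /=; case: ifP => _; split; rewrite ?(Hx _).1 ?(Hx _).2 ?(Kx _).1 ?(Kx _).2.
Qed.

Definition homotopic_equiv :=
  EquivRel homotopic homotopic_refl homotopic_sym homotopic_trans.

Definition concat_fun p q (t : I) : T :=
  if \val t <= 1 / 2 then p (clamp (2 * \val t + 0))
  else q (clamp (2 * \val t + -1)).

Fact concat_continuous p q : continuous (concat_fun p q).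
Proof.
apply: continuous_piecewise.
- exact: val_continuous.
- move=> t; apply: (@continuous_comp _ _ _ (fun t : I => clamp (2 * \val t + 0)) p).
    apply: continuous_clamp_affine; exact: val_continuous.
  exact: cts_fun.
- move=> t; apply: (@continuous_comp _ _ _ (fun t : I => clamp (2 * \val t + -1)) q).
    apply: continuous_clamp_affine; exact: val_continuous.
  exact: cts_fun.
- move=> t ->.
  have -> : 2 * (1 / 2) + 0 = 1 :> R by lra.
  have -> : 2 * (1 / 2) + -1 = 0 :> R by lra.
  by rewrite -/one -/zero path_one path_zero.
Qed.

Fact concat_zero p q : concat_fun p q zero = x.
Proof.
rewrite /concat_fun val_zero ifT; last by lra.
by rewrite mulr0 addr0 path_zero.
Qed.

Fact concat_one p q : concat_fun p q one = x.
Proof.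
rewrite /concat_fun val_one ifF; last by apply/negbTE; lra.
have -> : 2 * 1 + -1 = 1 :> R by lra.
by rewrite path_one.
Qed.

Definition concat p q : loop R x :=
  mk_path (@concat_continuous p q) (@concat_zero p q) (@concat_one p q).

Lemma concatE p q t : concat p q t =
  if \val t <= 1 / 2 then p (clamp (2 * \val t + 0))
  else q (clamp (2 * \val t + -1)).
Proof. by []. Qed.

Definition reverse_fun p (t : I) : T := p (clamp (-1 * \val t + 1)).

Fact reverse_continuous p : continuous (reverse_fun p).
Proof.
move=> t; apply: (@continuous_comp _ _ _ (fun t : I => clamp (-1 * \val t + 1)) p).
  apply: continuous_clamp_affine; exact: val_continuous.
exact: cts_fun.
Qed.

Fact reverse_zero p : reverse_fun p zero = x.
Proof. by rewrite /reverse_fun val_zero mulr0 add0r path_one. Qed.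

Fact reverse_one p : reverse_fun p one = x.
Proof. by rewrite /reverse_fun val_one mulr1 addNr path_zero. Qed.

Definition reverse p : loop R x :=
  mk_path (@reverse_continuous p) (@reverse_zero p) (@reverse_one p).

Lemma reverseE p t : reverse p t = p (clamp (-1 * \val t + 1)).
Proof. by []. Qed.

Definition const_loop : loop R x := cst x.

Lemma homotopic_concat p p' q q' :
  homotopic p p' -> homotopic q q' -> homotopic (concat p q) (concat p' q').
Proof.
move=> /asboolP[H [cH H01 Hx]] /asboolP[K [cK K01 Kx]]; apply/asboolP.
exists (fun z => if \val z.1 <= 1 / 2 then H (clamp (2 * \val z.1 + 0), z.2)
                 else K (clamp (2 * \val z.1 + -1), z.2)).
split.
- apply: continuous_piecewise.
  + exact: continuous_valfst.
  + apply: continuous_pair_comp => //; last exact: continuous_snd.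
    apply: continuous_clamp_affine; exact: continuous_valfst.
  + apply: continuous_pair_comp => //; last exact: continuous_snd.
    apply: continuous_clamp_affine; exact: continuous_valfst.
  + move=> [t s] /= ->.
    have -> : 2 * (1 / 2) + 0 = 1 :> R by lra.
    have -> : 2 * (1 / 2) + -1 = 0 :> R by lra.
    by rewrite (Hx s).2 (Kx s).1.
- move=> t /=; rewrite /mk_path /concat_fun; case: ifP => _.
    by rewrite !(H01 _).1 !(H01 _).2.
  by rewrite !(K01 _).1 !(K01 _).2.
- move=> s; cbv beta; rewrite !pair1E !pair2E val_zero val_one ifT; last by lra.
  rewrite ifF; last by apply/negbTE; lra.
  rewrite mulr0 addr0 (Hx s).1; split=> //.
  have -> : 2 * 1 + -1 = 1 :> R by lra.
  by rewrite (Kx s).2.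
Qed.

Lemma homotopic_reverse p p' :
  homotopic p p' -> homotopic (reverse p) (reverse p').
Proof.
move=> /asboolP[H [cH H01 Hx]]; apply/asboolP.
exists (fun z => H (clamp (-1 * \val z.1 + 1), z.2)); split=> [|t|s].
- apply: continuous_pair_comp => //; last exact: continuous_snd.
  apply: continuous_clamp_affine; exact: continuous_valfst.
- exact: H01.
- cbv beta; rewrite !pair1E !pair2E val_zero val_one mulr0 add0r mulr1 addNr.
  by rewrite (Hx s).1 (Hx s).2.
Qed.

End Homotopy.

Definition pi1 (R : realType) (T : topologicalType) (x : T) : Type :=
  {eq_quot @homotopic_equiv R T x}.

Section FundamentalGroup.
Context {R : realType} {T : topologicalType} {x : T}.
Local Notation I := (unit_interval R).
Local Notation pi1 := (@pi1 R T x).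
Implicit Types (p q : loop R x) (a b c : pi1).

HB.instance Definition _ := Choice.on pi1.
HB.instance Definition _ := EqQuotient.on pi1.

Definition pi1_one : pi1 := \pi_pi1 (const_loop : loop R x).
Definition pi1_inv a : pi1 := \pi_pi1 (reverse (repr a)).
Definition pi1_mul a b : pi1 := \pi_pi1 (concat (repr a) (repr b)).

Lemma pi1_eqP p q : \pi_pi1 p = \pi_pi1 q <-> homotopic p q.
Proof. by split=> [/eqmodP|h]; [|apply/eqmodP]. Qed.

Lemma pi1_mulE p q : pi1_mul (\pi_pi1 p) (\pi_pi1 q) = \pi_pi1 (concat p q).
Proof. by apply/pi1_eqP/homotopic_concat; apply/pi1_eqP; rewrite reprK. Qed.

Lemma pi1_invE p : pi1_inv (\pi_pi1 p) = \pi_pi1 (reverse p).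
Proof. by apply/pi1_eqP/homotopic_reverse; apply/pi1_eqP; rewrite reprK. Qed.

Let continuous_affine_comp (S : topologicalType) (f : S -> R) (k l : R) :
  continuous f -> continuous (fun t => k * f t + l).
Proof.
move=> cf t; apply: cvgD; last exact: cvg_cst.
by apply: cvgM; [exact: cvg_cst|exact: cf].
Qed.

Let continuous_affine (k l : R) : continuous (fun t : I => k * \val t + l).
Proof. by apply: continuous_affine_comp; exact: val_continuous. Qed.

Let minE (f g : I -> R) t : (f \min g) t = Num.min (f t) (g t).
Proof. by []. Qed.
Let maxE (f g : I -> R) t : (f \max g) t = Num.max (f t) (g t).
Proof. by []. Qed.

Let cstE (k : R) (t : I) : cst k t = k. Proof. by []. Qed.

Let homotopic_same (p q : loop R x) : p =1 q -> homotopic p q.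
Proof. by move=> /path_eqP ->; exact: homotopic_refl. Qed.

Fact pi1_mulA : associative pi1_mul.
Proof.
move=> a b c; rewrite -[a]reprK -[b]reprK -[c]reprK.
move: (repr a) (repr b) (repr c) => p q r.
rewrite (pi1_mulE q r) (pi1_mulE p q) (pi1_mulE p (concat q r)).
rewrite (pi1_mulE (concat p q) r).
apply/pi1_eqP; rewrite homotopic_sym; apply/asboolP.
pose P := concat p (concat q r).
apply: (@homotopic_reparam _ _ _ P
  ((fun t : I => (2 * \val t + 0 : R^o)) \min
   ((fun t : I => (1 * \val t + 1 / 4 : R^o)) \min
    (fun t : I => (1 / 2 * \val t + 1 / 2 : R^o)))) (\val : I -> R)).
- exact: cts_fun.
- by move=> t; apply: continuous_min; [|apply: continuous_min];
    exact: continuous_affine.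
- exact: val_continuous.
- rewrite ?minE ?maxE ?cstE val_zero min_l; first by lra.
  by rewrite le_min; apply/andP; split; lra.
- rewrite ?minE ?maxE ?cstE val_one min_r; last by rewrite ge_min; apply/orP; right; lra.
  by rewrite min_r; lra.
- move=> t; have t0 := val_ge0 t; have t1 := val_le1 t.
  rewrite 2!minE /P !concatE.
  have [t4|t4] := leP (\val t) (1 / 4).
    rewrite min_l; last by rewrite le_min; apply/andP; split; lra.
    rewrite val_clamp; last by apply/andP; split; lra.
    by rewrite !ifT //; lra.
  have [t2|t2] := leP (\val t) (1 / 2).
    rewrite min_r; last by rewrite ge_min; apply/orP; left; lra.
    rewrite min_l; last by lra.
    rewrite val_clamp; last by apply/andP; split; lra.
    rewrite ifF; last by apply/negbTE; lra.
    rewrite val_clamp; last by apply/andP; split; lra.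
    rewrite ifF; last by apply/negbTE; lra.
    rewrite val_clamp; last by apply/andP; split; lra.
    rewrite ifT; last by lra.
    by congr (q (clamp _)); lra.
  rewrite min_r; last by rewrite ge_min; apply/orP; right; lra.
  rewrite min_r; last by lra.
  rewrite val_clamp; last by apply/andP; split; lra.
  rewrite ifF; last by apply/negbTE; lra.
  rewrite val_clamp; last by apply/andP; split; lra.
  rewrite ifF; last by apply/negbTE; lra.
  by congr (r (clamp _)); lra.
- by move=> t; rewrite valK_clamp.
Qed.

Fact pi1_mul1g : left_id pi1_one pi1_mul.
Proof.
move=> a; rewrite -[a]reprK; move: (repr a) => p.
rewrite (pi1_mulE const_loop p); apply/pi1_eqP/asboolP.
apply: (@homotopic_reparam _ _ _ p
  ((fun t : I => (2 * \val t + -1 : R^o)) \max (cst (0 : R^o))) (\val : I -> R)).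
- exact: cts_fun.
- move=> t; apply: continuous_max; first exact: continuous_affine.
  exact: cst_continuous.
- exact: val_continuous.
- by rewrite ?minE ?maxE ?cstE val_zero max_r //; lra.
- by rewrite ?minE ?maxE ?cstE val_one max_l; lra.
- move=> t; rewrite concatE ?minE ?maxE ?cstE; case: ifP => t2.
    by rewrite max_r; [rewrite -/zero path_zero|lra].
  by rewrite max_l //; move/negbT: t2; lra.
- by move=> t; rewrite valK_clamp.
Qed.

Fact pi1_mulg1 : right_id pi1_one pi1_mul.
Proof.
move=> a; rewrite -[a]reprK; move: (repr a) => p.
rewrite (pi1_mulE p const_loop); apply/pi1_eqP/asboolP.
apply: (@homotopic_reparam _ _ _ p
  ((fun t : I => (2 * \val t + 0 : R^o)) \min (cst (1 : R^o))) (\val : I -> R)).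
- exact: cts_fun.
- move=> t; apply: continuous_min; first exact: continuous_affine.
  exact: cst_continuous.
- exact: val_continuous.
- by rewrite ?minE ?maxE ?cstE val_zero min_l; lra.
- by rewrite ?minE ?maxE ?cstE val_one min_r //; lra.
- move=> t; rewrite concatE ?minE ?maxE ?cstE; case: ifP => t2.
    by rewrite min_l //; lra.
  by rewrite min_r; [rewrite -/one path_one|move/negbT: t2; lra].
- by move=> t; rewrite valK_clamp.
Qed.

Fact pi1_mulgV : right_inverse pi1_one pi1_inv pi1_mul.
Proof.
move=> a; rewrite -[a]reprK; move: (repr a) => p.
rewrite (pi1_invE p) (pi1_mulE p (reverse p)).
apply/pi1_eqP/asboolP.
apply: (@homotopic_reparam _ _ _ p
  ((fun t : I => (2 * \val t + 0 : R^o)) \min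
   (fun t : I => (-2 * \val t + 2 : R^o))) (cst 0 : I -> R)).
- exact: cts_fun.
- by move=> t; apply: continuous_min; exact: continuous_affine.
- exact: cst_continuous.
- by rewrite ?minE ?maxE ?cstE val_zero min_l; lra.
- by rewrite ?minE ?maxE ?cstE val_one min_r; lra.
- move=> t; have t0 := val_ge0 t; have t1 := val_le1 t.
  rewrite concatE ?minE ?maxE ?cstE; case: ifP => t2.
    by rewrite min_l //; lra.
  move/negbT: t2 => t2; rewrite min_r; last by lra.
  rewrite reverseE val_clamp; last by apply/andP; split; lra.
  by congr (p (clamp _)); lra.
- by move=> t; rewrite -/zero path_zero.
Qed.

Fact pi1_mulVg : left_inverse pi1_one pi1_inv pi1_mul.
Proof.
move=> a.
have e : pi1_inv (pi1_inv a) = a.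
  rewrite -[a]reprK; move: (repr a) => p.
  rewrite (pi1_invE p) (pi1_invE (reverse p)).
  apply/pi1_eqP/homotopic_same => t.
  have t0 := val_ge0 t; have t1 := val_le1 t.
  rewrite !reverseE val_clamp; last by apply/andP; split; lra.
  rewrite -[in RHS](valK_clamp t); congr (_ (clamp _)); lra.
by rewrite -{2}e pi1_mulgV.
Qed.

HB.instance Definition _ :=
  isGroup.Build pi1 pi1_mulA pi1_mul1g pi1_mulg1 pi1_mulVg pi1_mulgV.

End FundamentalGroup.

Definition group_isomorphic (G H : groupType) : Prop :=
  exists f : {multiplicative G -> H}, bijective f.

Definition sym_sdprod (G : groupType) (n : nat) : Type :=
  ({ffun 'I_n -> G} * 'S_n)%type.

Section SymSdprod.
Context {G : groupType} {n : nat}.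
Local Notation W := (sym_sdprod G n).
Local Open Scope group_scope.
Implicit Types a b : W.

HB.instance Definition _ := Choice.on W.

(* [(s * t)%g] is [t \o s] in [perm], hence [b.2 * a.2] for a.2 \o b.2. *)
Definition sym_sdprod_mul a b : W :=
  ([ffun i => a.1 i * b.1 (a.2^-1 i)], b.2 * a.2).
Definition sym_sdprod_one : W := ([ffun=> 1], 1).
Definition sym_sdprod_inv a : W := ([ffun i => (a.1 (a.2 i))^-1], a.2^-1).

Fact sym_sdprod_mulA : associative sym_sdprod_mul.
Proof.
move=> a b c; congr (_, _) => /=; last by rewrite mulgA.
by apply/ffunP => i; rewrite !ffunE /= mulgA invMg permM.
Qed.

Fact sym_sdprod_mul1g : left_id sym_sdprod_one sym_sdprod_mul.
Proof.
move=> [a s]; congr (_, _) => /=; last by rewrite mulg1.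
by apply/ffunP => i; rewrite !ffunE /= mul1g invg1 perm1.
Qed.

Fact sym_sdprod_mulg1 : right_id sym_sdprod_one sym_sdprod_mul.
Proof.
move=> [a s]; congr (_, _) => /=; last by rewrite mul1g.
by apply/ffunP => i; rewrite !ffunE /= mulg1.
Qed.

Fact sym_sdprod_mulVg :
  left_inverse sym_sdprod_one sym_sdprod_inv sym_sdprod_mul.
Proof.
move=> [a s]; congr (_, _) => /=; last by rewrite mulgV.
by apply/ffunP => i; rewrite !ffunE /= invgK mulVg.
Qed.

Fact sym_sdprod_mulgV :
  right_inverse sym_sdprod_one sym_sdprod_inv sym_sdprod_mul.
Proof.
move=> [a s]; congr (_, _) => /=; last by rewrite mulVg.
by apply/ffunP => i; rewrite !ffunE /= permKV mulgV.
Qed.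

HB.instance Definition _ := isGroup.Build W sym_sdprod_mulA
  sym_sdprod_mul1g sym_sdprod_mulg1 sym_sdprod_mulVg sym_sdprod_mulgV.
End SymSdprod.

Definition Fconf (n : nat) (X : topologicalType) : topologicalType :=
  set_type [set x : prod_topology (fun _ : 'I_n => X) | injective x].

(* Its topology, declared below, is the quotient topology along [config_set]. *)
Definition Dconf (n : nat) (X : topologicalType) : Type :=
  {A : set X | A #= `I_n}.

Section ConfigurationSpace.
Context {n : nat} {X : topologicalType}.
Local Notation F := (Fconf n X).
Local Notation D := (Dconf n X).

Lemma Fconf_inj (x : F) : injective (\val x).
Proof. by case: x => x /= /set_mem. Qed.

Fact config_set_subproof (x : F) : range (\val x) #= `I_n.
Proof.
rewrite card_eq_sym; apply/card_bijP.
have vP (i : `I_n) : (\val i < n)%N by case: i => i /= /set_mem.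
have xP (i : 'I_n) : \val x i \in range (\val x) by apply/mem_set; exists i.
exists (fun i : `I_n => exist _ (\val x (Ordinal (vP i))) (xP (Ordinal (vP i)))).
rewrite -setTT_bijective; split=> //.
- move=> i j _ _ /(congr1 val) /= /Fconf_inj /(congr1 val) /= ij.
  exact: val_inj.
- move=> [y yP] _; have [i _ xi] := set_mem yP.
  have iP : \val i \in `I_n by apply/mem_set; exact: ltn_ord.
  exists (exist _ (\val i) iP) => //; apply: val_inj => /=.
  by rewrite -xi; congr (\val x _); exact: val_inj.
Qed.

Definition config_set (x : F) : D := exist _ (range (\val x)) (config_set_subproof x).

Fact config_set_surj (A : D) : exists x : F, config_set x = A.
Proof.
case: A => A An; have := An; rewrite card_eq_sym => /card_bijP[f bf].
have vP (i : 'I_n) : (i : nat) \in `I_n by apply/mem_set; exact: ltn_ord.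
pose x (i : 'I_n) : X := \val (f (exist _ (i : nat) (vP i))).
have xinj : injective x.
  by move=> i j /val_inj /(bij_inj bf) /(congr1 val) /= ij; exact: val_inj.
exists (exist _ (x : prod_topology (fun _ : 'I_n => X)) (mem_set xinj)).
apply: val_inj => /=; apply/seteqP; split=> [_ [i _ <-]|y Ay].
  by rewrite /x; case: (f _) => z /= /set_mem.
have [g fK gK] := bf; pose z : A := exist _ y (mem_set Ay).
have gz : (\val (g z) < n)%N by case: (g z) => i /= /set_mem.
exists (Ordinal gz) => //; rewrite /x.
rewrite (_ : exist _ _ _ = g z); last exact: val_inj.
by rewrite gK.
Qed.

Definition ordering (A : D) : F := projT1 (cid (config_set_surj A)).

Fact orderingK : cancel ordering config_set.
Proof. by move=> A; exact: projT2 (cid (config_set_surj A)). Qed.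

HB.instance Definition _ := isQuotient.Build F D orderingK.
HB.instance Definition _ := Topological.copy D (quotient_topology D).

Lemma Dconf_openE (U : set D) : open U = open (config_set @^-1` U).
Proof.
rewrite -[LHS]/(open (\pi_(quotient_topology D) @^-1` U)).
by rewrite (_ : \pi_(quotient_topology D) = config_set) // unlock.
Qed.

(* The fibres of [config_set] are exactly the orbits of the symmetric group. *)
Lemma config_set_eqP (x y : F) :
  config_set x = config_set y <-> exists s : 'S_n, \val y = \val x \o s.
Proof.
split=> [/(congr1 val) /= xy|[s yE]]; last first.
  apply: val_inj => /=; rewrite yE; apply/seteqP; split=> _ [i _ <-].
    by exists (s^-1%g i) => //=; rewrite permKV.
  by exists (s i).
have h i : exists j, \val x j = \val y i.
  by have : range (\val y) (\val y i) by [exists i]; rewrite -xy => -[j _ <-]; exists j.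
pose s i := projT1 (cid (h i)).
have sE i : \val x (s i) = \val y i := projT2 (cid (h i)).
have sinj : injective s by move=> i j /(congr1 (\val x)); rewrite !sE => /Fconf_inj.
by exists (perm sinj); apply/funext => i /=; rewrite permE sE.
Qed.

End ConfigurationSpace.

Definition homeomorphic (X Y : topologicalType) : Prop :=
  exists (f : X -> Y) (g : Y -> X),
    [/\ continuous f, continuous g, cancel f g & cancel g f].

(* Finite abstract simplicial complexes with vertices among [0, ..., m-1]. *)
Definition simplicial_complex (m : nat) (K : {set {set 'I_m}}) : Prop :=
  finset.set0 \notin K /\
  forall s t : {set 'I_m},
    s \in K -> t \subset s -> t != finset.set0 -> t \in K.

(* The union, over the simplices [s] of [K], of the convex hulls of the basis
   vectors indexed by [s]. *)
Definition geometric_realization (R : realType) (m : nat)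
    (K : {set {set 'I_m}}) : set 'rV[R]_m :=
  [set t | [/\ forall i, 0 <= t 0 i, \sum_i t 0 i = 1
             & finset (fun i => t 0 i != 0) \in K]].

Definition finite_polyhedron (R : realType) (X : topologicalType) : Prop :=
  exists (m : nat) (K : {set {set 'I_m}}),
    simplicial_complex K /\ homeomorphic X (set_type (@geometric_realization R m K)).

Definition iter_partial (R : realType) (d e : nat) (s : seq 'I_d)
    (f : 'rV[R]_d -> 'rV[R]_e) : 'rV[R]_d -> 'rV[R]_e :=
  foldr (fun i g => 'D_(delta_mx 0 i) g) f s.

(* Meant for open [U], on which the derivatives depend only on [f] near [U]. *)
Definition smooth_on (R : realType) (d e : nat) (U : set 'rV[R]_d)
    (f : 'rV[R]_d -> 'rV[R]_e) : Prop :=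
  forall (s : seq 'I_d) (x : 'rV[R]_d), U x ->
    {for x, continuous (iter_partial s f)} /\
    forall i : 'I_d, derivable (iter_partial s f) x (delta_mx 0 i).

(* [chart_map] and [chart_inv] are relevant only on [chart_dom] and on its
   image, respectively. *)
Record chart (R : realType) (d : nat) (X : topologicalType) := Chart {
  chart_dom : set X;
  chart_map : X -> 'rV[R]_d;
  chart_inv : 'rV[R]_d -> X;
  chart_dom_open : open chart_dom;
  chart_codom_open : open (chart_map @` chart_dom);
  chart_mapK : {in chart_dom, cancel chart_map chart_inv};
  chart_map_continuous : {within chart_dom, continuous chart_map};
  chart_inv_continuous : {within chart_map @` chart_dom, continuous chart_inv}
}.

Definition smooth_compatible (R : realType) (d : nat) (X : topologicalType)
    (a b : chart R d X) : Prop :=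
  smooth_on (chart_map a @` (chart_dom a `&` chart_dom b))
            (chart_map b \o chart_inv a).

Definition smooth_atlas (R : realType) (d : nat) (X : topologicalType)
    (A : set (chart R d X)) : Prop :=
  \bigcup_(a in A) chart_dom a = [set: X] /\
  forall a b, A a -> A b -> smooth_compatible a b.

Definition smooth_manifold (R : realType) (d : nat) (X : topologicalType) : Prop :=
  [/\ hausdorff_space X, @second_countable X
    & exists A : set (chart R d X), smooth_atlas A].

(* Main.v *)
Require Import Defs.
From HB Require Import structures.
From mathcomp Require Import all_boot all_order all_algebra all_fingroup.
From mathcomp Require Import generic_quotient.
From mathcomp Require Import all_classical reals topology.
From mathcomp Require Import normedtype sequences homotopy.
From mathcomp Require Import ring lra.

(** Let [M] be the [n]-th power of [X], and call a point of [M] a configuration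
    when its coordinates are distinct.  Forgetting the order of the coordinates is
    a covering of the space of unordered configurations, with the symmetric group
    as its group of deck transformations, so a braid lifts to a path in [M] from a
    fixed ordering [y] of the base configuration to a permutation of [y].  After
    closing up its strands with paths from the base point of [X] to the points of
    [y], it yields a permutation and [n] elements of the fundamental group of [X],
    and this monodromy is multiplicative for the law of the semidirect product.
    It is bijective because the fat diagonal of [M] has codimension at least 3:
    paths can be pushed off it without changing their homotopy class
    ([path_off_diagonal], which gives surjectivity), and so can homotopies
    ([homotopy_off_diagonal], which gives injectivity).

    Both the homotopy invariance of the monodromy and the second general position
    statement are instances of one principle, [homotopic_congruent]: let [U] be a
    subset of a space, and [E] an equivalence on paths in [U], compatible with
    concatenation and reparametrisation.  If the space has a basis of open sets in
    which [U] is nonempty and path connected and in which paths in [U] with common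
    endpoints are equivalent, then any homotopy in the whole space, even one that
    leaves [U], implies equivalence.  For the monodromy, [U] is the whole space of
    unordered configurations and [E] says that lifts with a common start are
    homotopic in [M].  For general position, [U] is the set of configurations in
    [M] and [E] is homotopy inside [U].

    The local hypothesis for general position concerns the complement, in a convex
    box of a power of a Euclidean space of dimension [d >= 3], of the subspaces
    where two given coordinates agree: it must be path connected and simply
    connected ([region_path_connected], [region_simply_connected]).  A path there
    is homotopic to a polygonal one, and a polygonal path is coned off from an
    apex: the cone over a segment meets such a subspace only if the difference of
    the two coordinates of the apex lies in a certain plane, and proper subspaces
    in finite number can be avoided ([homotopic_cone]). *)

Set Implicit Arguments.
Unset Strict Implicit.
Unset Printing Implicit Defensive.

Import Order.TTheory GRing.Theory Num.Theory.
Import numFieldNormedType.Exports.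

Local Open Scope classical_set_scope.
Local Open Scope ring_scope.
Local Open Scope quotient_scope.

(** * Paths, reparametrisation and concatenation *)

Section Paths.
Context {R : realType}.
Local Notation I := (unit_interval R).

Lemma continuous_clamp_comp (S : topologicalType) (f : S -> R) :
  continuous f -> continuous (fun z => clamp (f z)).
Proof.
move=> cf z; apply: (@continuous_comp _ _ _ f clamp); first exact: cf.
exact: clamp_continuous.
Qed.

Lemma continuous_affine_val (a b : R) : continuous (fun t : I => a * \val t + b).
Proof.
have h (S : topologicalType) (f : S -> R) :
    continuous f -> continuous (fun t => a * f t + b).
  move=> cf t; apply: cvgD; last exact: cvg_cst.
  by apply: cvgM; [exact: cvg_cst|exact: cf].
by apply: h; exact: val_continuous.
Qed.

Lemma continuous_comp_fun (A B C : topologicalType) (f : A -> B) (g : B -> C) :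
  continuous f -> continuous g -> continuous (fun x => g (f x)).
Proof.
move=> cf cg x; apply: (@continuous_comp _ _ _ f g); first exact: cf.
exact: cg.
Qed.

Section PathOps.
Context {T : Type}.
Implicit Types p q r : I -> T.

Definition path_concat p q : I -> T := fun t =>
  if \val t <= 1 / 2 then p (clamp (2 * \val t + 0))
  else q (clamp (2 * \val t + -1)).

Definition path_rev p : I -> T := fun t => p (clamp (-1 * \val t + 1)).
Definition first_half p : I -> T := fun t => p (clamp (1 / 2 * \val t + 0)).
Definition second_half p : I -> T := fun t => p (clamp (1 / 2 * \val t + 1 / 2)).

Lemma path_concat0 p q : path_concat p q zero = p zero.
Proof.
rewrite /path_concat val_zero ifT; last by lra.
by rewrite mulr0 addr0.
Qed.

Lemma path_concat1 p q : path_concat p q one = q one.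
Proof.
rewrite /path_concat val_one ifF; last by apply/negbTE; lra.
by congr (q (clamp _)); lra.
Qed.

Lemma path_rev0 p : path_rev p zero = p one.
Proof. by rewrite /path_rev val_zero mulr0 add0r. Qed.

Lemma path_rev1 p : path_rev p one = p zero.
Proof. by rewrite /path_rev val_one mulr1 addNr. Qed.

Lemma path_revK p : path_rev (path_rev p) = p.
Proof.
apply/funext => t; have t0 := val_ge0 t; have t1 := val_le1 t.
rewrite /path_rev val_clamp; last by apply/andP; split; lra.
by rewrite -[in RHS](valK_clamp t); congr (_ (clamp _)); lra.
Qed.

Lemma first_half0 p : first_half p zero = p zero.
Proof. by rewrite /first_half val_zero mulr0 addr0. Qed.

Lemma first_half1 p : first_half p one = second_half p zero.
Proof. by rewrite /first_half /second_half val_zero val_one; congr (p (clamp _)); lra. Qed.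

Lemma second_half1 p : second_half p one = p one.
Proof. by rewrite /second_half val_one; congr (p (clamp _)); lra. Qed.

Lemma concat_halves p : path_concat (first_half p) (second_half p) = p.
Proof.
apply/funext => t; have t0 := val_ge0 t; have t1 := val_le1 t.
rewrite /path_concat /first_half /second_half -[in RHS](valK_clamp t).
case: ifPn => t2; rewrite val_clamp; try by apply/andP; split; lra.
  by congr (p (clamp _)); lra.
by congr (p (clamp _)); lra.
Qed.

Lemma first_half_concat p q : p one = q zero -> first_half (path_concat p q) = p.
Proof.
move=> pq; apply/funext => t; have t0 := val_ge0 t; have t1 := val_le1 t.
rewrite /path_concat /first_half val_clamp; last by apply/andP; split; lra.
rewrite ifT; last by lra.
by rewrite -[in RHS](valK_clamp t); congr (p (clamp _)); lra.
Qed.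

Lemma second_half_concat p q : p one = q zero -> second_half (path_concat p q) = q.
Proof.
move=> pq; apply/funext => t; have t0 := val_ge0 t; have t1 := val_le1 t.
rewrite /path_concat /second_half val_clamp; last by apply/andP; split; lra.
case: ifPn => t2; last first.
  by rewrite -[in RHS](valK_clamp t); congr (q (clamp _)); lra.
(* At the midpoint the formula of [path_concat] picks the end of [p]. *)
have tz : \val t = 0 by lra.
rewrite -[in RHS](valK_clamp t) tz -/zero -pq; congr (p (clamp _)); lra.
Qed.

Lemma path_concatP (P : set T) p q :
  (forall t, P (p t)) -> (forall t, P (q t)) -> forall t, P (path_concat p q t).
Proof. by move=> Pp Pq t; rewrite /path_concat; case: ifP. Qed.

(** The associativity and unit laws hold up to a reparametrisation of the
    interval, which is what makes them available for every relation on paths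
    that ignores parametrisations, and not only for homotopy. *)
Definition reparam (phi : I -> I) : Prop :=
  [/\ continuous phi, phi zero = zero & phi one = one].

Lemma concat_assoc_reparam p q r : exists2 phi, reparam phi &
  path_concat (path_concat p q) r = path_concat p (path_concat q r) \o phi.
Proof.
pose f t : R := Num.min (2 * \val (t : I) + 0)
  (Num.min (1 * \val t + 1 / 4) (1 / 2 * \val t + 1 / 2)).
exists (fun t => clamp (f t)).
  split.
  - apply: continuous_clamp_comp => t.
    have h : {for t, continuous ((fun t : I => (2 * \val t + 0 : R^o)) \min
      ((fun t : I => (1 * \val t + 1 / 4 : R^o)) \min
       (fun t : I => (1 / 2 * \val t + 1 / 2 : R^o))))}.
      by apply: continuous_min; [|apply: continuous_min]; exact: continuous_affine_val.
    exact: h.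
  - rewrite /f val_zero min_l; first by rewrite mulr0 addr0.
    by rewrite le_min; apply/andP; split; lra.
  - rewrite /f val_one min_r; last by rewrite ge_min; apply/orP; right; lra.
    by rewrite min_r; [congr clamp; lra|lra].
apply/funext => t; have t0 := val_ge0 t; have t1 := val_le1 t.
rewrite /= /f /path_concat.
have [t4|t4] := leP (\val t) (1 / 4).
  rewrite min_l; last by rewrite le_min; apply/andP; split; lra.
  rewrite val_clamp; last by apply/andP; split; lra.
  by rewrite !ifT //; lra.
have [t2|t2] := leP (\val t) (1 / 2).
  rewrite min_r; last by rewrite ge_min; apply/orP; left; lra.
  rewrite min_l; last by lra.
  rewrite val_clamp; last by apply/andP; split; lra.
  rewrite ifF; last by apply/negbTE; lra.
  rewrite val_clamp; last by apply/andP; split; lra.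
  rewrite ifF; last by apply/negbTE; lra.
  rewrite val_clamp; last by apply/andP; split; lra.
  rewrite ifT; last by lra.
  by congr (q (clamp _)); lra.
rewrite min_r; last by rewrite ge_min; apply/orP; right; lra.
rewrite min_r; last by lra.
rewrite val_clamp; last by apply/andP; split; lra.
rewrite ifF; last by apply/negbTE; lra.
rewrite val_clamp; last by apply/andP; split; lra.
rewrite ifF; last by apply/negbTE; lra.
by congr (r (clamp _)); lra.
Qed.

Lemma concat_cstl_reparam p : exists2 phi, reparam phi &
  path_concat (fun=> p zero) p = p \o phi.
Proof.
pose f t : R := Num.max (2 * \val (t : I) + -1) 0.
exists (fun t => clamp (f t)).
  split.
  - apply: continuous_clamp_comp => t.
    have h : {for t, continuous ((fun t : I => (2 * \val t + -1 : R^o)) \max (cst (0 : R^o)))}.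
      by apply: continuous_max; [exact: continuous_affine_val|exact: cst_continuous].
    exact: h.
  - by rewrite /f val_zero max_r //; lra.
  - by rewrite /f val_one max_l; [congr clamp; lra|lra].
apply/funext => t; have t0 := val_ge0 t; have t1 := val_le1 t.
rewrite /= /f /path_concat; case: ifPn => t2.
  by rewrite max_r; [|lra].
by rewrite max_l //; lra.
Qed.

Lemma concat_cstr_reparam p : exists2 phi, reparam phi &
  path_concat p (fun=> p one) = p \o phi.
Proof.
pose f t : R := Num.min (2 * \val (t : I) + 0) 1.
exists (fun t => clamp (f t)).
  split.
  - apply: continuous_clamp_comp => t.
    have h : {for t, continuous ((fun t : I => (2 * \val t + 0 : R^o)) \min (cst (1 : R^o)))}.
      by apply: continuous_min; [exact: continuous_affine_val|exact: cst_continuous].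
    exact: h.
  - by rewrite /f val_zero min_l; [congr clamp; lra|lra].
  - by rewrite /f val_one min_r //; lra.
apply/funext => t; have t0 := val_ge0 t; have t1 := val_le1 t.
rewrite /= /f /path_concat; case: ifPn => t2.
  by rewrite min_l //; lra.
by rewrite min_r; [|lra].
Qed.

End PathOps.

Lemma comp_concat (A B : Type) (f : A -> B) (p q : I -> A) :
  (fun t => f (path_concat p q t)) = path_concat (fun t => f (p t)) (fun t => f (q t)).
Proof. by apply/funext => t; rewrite /path_concat; case: ifP. Qed.

Section PathContinuity.
Context {T : topologicalType}.
Implicit Types (p q r : I -> T) (S : set T).

Definition path_in S p : Prop := continuous p /\ forall t, S (p t).

Lemma path_inS S S' p : S `<=` S' -> path_in S p -> path_in S' p.
Proof. by move=> SS' [cp Sp]; split=> // t; exact: SS'. Qed.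

Lemma path_in_cst S x : S x -> path_in S (fun=> x).
Proof. by move=> Sx; split=> //; exact: cst_continuous. Qed.

Lemma path_in_affine S p a b : path_in S p ->
  path_in S (fun t => p (clamp (a * \val t + b))).
Proof.
move=> [cp Sp]; split=> //.
by apply: continuous_comp_fun => //; apply: continuous_clamp_comp; exact: continuous_affine_val.
Qed.

Lemma path_in_concat S p q : path_in S p -> path_in S q -> p one = q zero ->
  path_in S (path_concat p q).
Proof.
move=> Sp Sq pq; split; last first.
  by apply: path_concatP => t; [exact: Sp.2|exact: Sq.2].
apply: continuous_piecewise.
- exact: val_continuous.
- exact: (path_in_affine _ _ Sp).1.
- exact: (path_in_affine _ _ Sq).1.
- move=> t ->.
  have -> : 2 * (1 / 2) + 0 = 1 :> R by lra.
  have -> : 2 * (1 / 2) + -1 = 0 :> R by lra.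
  by rewrite -/one -/zero.
Qed.

Lemma path_in_rev S p : path_in S p -> path_in S (path_rev p).
Proof. exact: path_in_affine. Qed.
Lemma path_in_first S p : path_in S p -> path_in S (first_half p).
Proof. exact: path_in_affine. Qed.
Lemma path_in_second S p : path_in S p -> path_in S (second_half p).
Proof. exact: path_in_affine. Qed.

Lemma path_in_reparam S p phi : path_in S p -> reparam phi -> path_in S (p \o phi).
Proof.
move=> [cp Sp] [cphi _ _]; split=> [|t]; last exact: Sp.
exact: continuous_comp_fun.
Qed.

End PathContinuity.

Lemma path_in_comp (A B : topologicalType) (S : set A) (S' : set B) (f : A -> B) p :
  (forall x, S x -> {for x, continuous f}) -> (forall x, S x -> S' (f x)) ->
  path_in S p -> path_in S' (f \o p).
Proof.
move=> cf SS' [cp Sp]; split=> [t|t]; last exact/SS'/Sp.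
by apply: (@continuous_comp _ _ _ p f); [exact: cp|exact: cf].
Qed.

End Paths.

(** * Path homotopies and induction by bisection *)

Section PathHomotopy.
Context {R : realType} {T : topologicalType}.
Local Notation I := (unit_interval R).
Implicit Types (p q r : I -> T) (S : set T).

Let pair1E (A B : Type) (a : A) (b : B) : (a, b).1 = a. Proof. by []. Qed.
Let pair2E (A B : Type) (a : A) (b : B) : (a, b).2 = b. Proof. by []. Qed.

(** Homotopy relative to the endpoints whose whole track stays in [S].  Recording
    [S] here avoids subspace types: paths in [S] and in the ambient space have
    the same type and can be compared. *)
Definition homotopic_in S p q : Prop :=
  exists H : I * I -> T,
    [/\ continuous H,
        forall t, H (t, zero) = p t /\ H (t, one) = q t,
        forall s, H (zero, s) = p zero /\ H (one, s) = p one
      & forall z, S (H z)].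

Lemma homotopic_in_ends S p q : homotopic_in S p q -> p zero = q zero /\ p one = q one.
Proof.
move=> [H [_ H01 He _]]; split.
  by rewrite -(H01 zero).2 (He one).1.
by rewrite -(H01 one).2 (He one).2.
Qed.

Lemma continuous_pairl (A B C : topologicalType) (f : A * B -> C) (b : B) :
  continuous f -> continuous (fun a => f (a, b)).
Proof.
move=> cf; apply: (continuous_pair_comp cf) => x; first exact: cvg_id.
exact: cvg_cst.
Qed.

Lemma homotopic_in_path S p q : homotopic_in S p q -> path_in S p /\ path_in S q.
Proof.
move=> [H [cH H01 He SH]]; split; split.
- rewrite (_ : p = fun t => H (t, zero)); first exact: continuous_pairl.
  by apply/funext => t; rewrite (H01 t).1.
- by move=> t; rewrite -(H01 t).1.
- rewrite (_ : q = fun t => H (t, one)); first exact: continuous_pairl.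
  by apply/funext => t; rewrite (H01 t).2.
- by move=> t; rewrite -(H01 t).2.
Qed.

(** Two reparametrisations of one path are joined by interpolating linearly
    between the parameters, so the unit, associativity and inverse laws come down
    to comparing piecewise affine functions. *)
Lemma homotopic_in_line S (p : I -> T) (phi psi : I -> R) q0 q1 :
  path_in S p -> continuous phi -> continuous psi ->
  phi zero = psi zero -> phi one = psi one ->
  (forall t, q0 t = p (clamp (phi t))) -> (forall t, q1 t = p (clamp (psi t))) ->
  homotopic_in S q0 q1.
Proof.
move=> [cp Sp] cphi cpsi e0 e1 q0E q1E.
exists (fun ts : I * I => p (clamp ((1 - \val ts.2) * phi ts.1 + \val ts.2 * psi ts.1))).
split=> //.
- have cs : continuous (fun ts : I * I => \val ts.2 : R) by exact: continuous_valsnd.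
  have c1 f : continuous f -> continuous (fun ts : I * I => f ts.1 : R).
    by move=> cf; apply: continuous_comp_fun cf => z; exact: cvg_fst.
  apply: continuous_comp_fun cp; apply: continuous_clamp_comp => z.
  apply: cvgD; apply: cvgM; [|exact: c1|exact: cs|exact: c1].
  by apply: cvgB; [exact: cvg_cst|exact: cs].
- move=> t; rewrite q0E q1E !pair1E !pair2E val_zero val_one.
  by split; congr (p (clamp _)); lra.
- move=> s /=; rewrite !q0E; split.
    by rewrite e0; congr (p (clamp _)); lra.
  by rewrite e1; congr (p (clamp _)); lra.
Qed.

Lemma homotopic_in_reparam S p phi : path_in S p -> reparam phi ->
  homotopic_in S p (p \o phi).
Proof.
move=> Sp [cphi phi0 phi1].
apply: (@homotopic_in_line S p (\val : I -> R) (fun t => \val (phi t))) => //.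
- exact: val_continuous.
- by apply: continuous_comp_fun cphi _; exact: val_continuous.
- by rewrite phi0.
- by rewrite phi1.
- by move=> t; rewrite valK_clamp.
- by move=> t; rewrite valK_clamp.
Qed.

Lemma homotopic_in_refl S p : path_in S p -> homotopic_in S p p.
Proof.
move=> Sp; have := @homotopic_in_reparam S p id Sp; apply; split=> // t.
exact: cvg_id.
Qed.

Lemma homotopic_inS S S' p q : S `<=` S' -> homotopic_in S p q -> homotopic_in S' p q.
Proof. by move=> SS' [H [cH H01 He SH]]; exists H; split=> // z; exact/SS'. Qed.

Lemma homotopic_in_sym S p q : homotopic_in S p q -> homotopic_in S q p.
Proof.
move=> h; have [e0 e1] := homotopic_in_ends h; move: h => [H [cH H01 Hx SH]].
exists (fun z => H (z.1, clamp (-1 * \val z.2 + 1))).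
split=> [|t|s|z] //.
- apply: continuous_pair_comp => //; first exact: continuous_fst.
  apply: continuous_clamp_affine; exact: continuous_valsnd.
- cbv beta; rewrite !pair1E !pair2E val_zero val_one mulr0 add0r mulr1 addNr.
  by have [-> ->] := H01 t.
- by rewrite -e0 -e1; exact: Hx.
Qed.

Lemma homotopic_in_trans S q p r :
  homotopic_in S p q -> homotopic_in S q r -> homotopic_in S p r.
Proof.
move=> h; have [e0 e1] := homotopic_in_ends h; move: h => [H [cH H01 Hx SH]].
move=> [K [cK K01 Kx SK]].
exists (fun z => if \val z.2 <= 1 / 2 then H (z.1, clamp (2 * \val z.2 + 0))
                 else K (z.1, clamp (2 * \val z.2 + -1))).
split.
- apply: continuous_piecewise.
  + exact: continuous_valsnd.
  + apply: continuous_pair_comp => //; first exact: continuous_fst.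
    apply: continuous_clamp_affine; exact: continuous_valsnd.
  + apply: continuous_pair_comp => //; first exact: continuous_fst.
    apply: continuous_clamp_affine; exact: continuous_valsnd.
  + move=> [t s] /= ->.
    have -> : 2 * (1 / 2) + 0 = 1 :> R by lra.
    have -> : 2 * (1 / 2) + -1 = 0 :> R by lra.
    by rewrite (H01 t).2 (K01 t).1.
- move=> t; cbv beta; rewrite !pair1E !pair2E val_zero val_one ifT; last by lra.
  rewrite ifF; last by apply/negbTE; lra.
  rewrite mulr0 addr0 (H01 t).1; split=> //.
  have -> : 2 * 1 + -1 = 1 :> R by lra.
  by rewrite (K01 t).2.
- move=> s /=; case: ifP => _; split; rewrite ?(Hx _).1 ?(Hx _).2 ?(Kx _).1 ?(Kx _).2 //.
- by move=> z; case: ifP.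
Qed.

Lemma homotopic_in_concat S p p' q q' : p one = q zero ->
  homotopic_in S p p' -> homotopic_in S q q' ->
  homotopic_in S (path_concat p q) (path_concat p' q').
Proof.
move=> pq [H [cH H01 Hx SH]] [K [cK K01 Kx SK]].
exists (fun z => if \val z.1 <= 1 / 2 then H (clamp (2 * \val z.1 + 0), z.2)
                 else K (clamp (2 * \val z.1 + -1), z.2)).
split.
- apply: continuous_piecewise.
  + exact: continuous_valfst.
  + apply: continuous_pair_comp => //; last exact: continuous_snd.
    apply: continuous_clamp_affine; exact: continuous_valfst.
  + apply: continuous_pair_comp => //; last exact: continuous_snd.
    apply: continuous_clamp_affine; exact: continuous_valfst.
  + move=> [t s] /= ->.
    have -> : 2 * (1 / 2) + 0 = 1 :> R by lra.
    have -> : 2 * (1 / 2) + -1 = 0 :> R by lra.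
    by rewrite (Hx s).2 (Kx s).1.
- move=> t /=; rewrite /path_concat; case: ifP => _.
    by rewrite !(H01 _).1 !(H01 _).2.
  by rewrite !(K01 _).1 !(K01 _).2.
- move=> s; cbv beta; rewrite path_concat0 path_concat1 !pair1E !pair2E val_zero val_one ifT; last by lra.
  rewrite ifF; last by apply/negbTE; lra.
  rewrite mulr0 addr0 (Hx s).1; split=> //.
  have -> : 2 * 1 + -1 = 1 :> R by lra.
  by rewrite (Kx s).2.
- by move=> z; case: ifP.
Qed.

Lemma homotopic_in_assoc S p q r : path_in S p -> path_in S q -> path_in S r ->
  p one = q zero -> q one = r zero ->
  homotopic_in S (path_concat (path_concat p q) r) (path_concat p (path_concat q r)).
Proof.
move=> Sp Sq Sr pq qr; have [phi rphi ->] := concat_assoc_reparam p q r.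
apply: homotopic_in_sym; apply: homotopic_in_reparam rphi.
by apply: path_in_concat => //; [exact: path_in_concat|rewrite path_concat0].
Qed.

Lemma homotopic_in_cstl S p : path_in S p ->
  homotopic_in S (path_concat (fun=> p zero) p) p.
Proof.
move=> Sp; have [phi rphi ->] := concat_cstl_reparam p.
exact/homotopic_in_sym/homotopic_in_reparam.
Qed.

Lemma homotopic_in_cstr S p : path_in S p ->
  homotopic_in S (path_concat p (fun=> p one)) p.
Proof.
move=> Sp; have [phi rphi ->] := concat_cstr_reparam p.
exact/homotopic_in_sym/homotopic_in_reparam.
Qed.

Lemma homotopic_in_revr S p : path_in S p ->
  homotopic_in S (path_concat p (path_rev p)) (fun=> p zero).
Proof.
move=> Sp; apply: (@homotopic_in_line S p
  ((fun t : I => (2 * \val t + 0 : R^o)) \min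
   (fun t : I => (-2 * \val t + 2 : R^o))) (cst 0 : I -> R)) => //.
- by move=> t; apply: continuous_min; exact: continuous_affine_val.
- exact: cst_continuous.
- by rewrite /Order.min_fun /cst val_zero min_l; lra.
- by rewrite /Order.min_fun /cst val_one min_r; lra.
- move=> t; have t0 := val_ge0 t; have t1 := val_le1 t.
  rewrite /path_concat /Order.min_fun; case: ifPn => t2.
    by rewrite min_l //; lra.
  rewrite min_r; last by lra.
  rewrite /path_rev val_clamp; last by apply/andP; split; lra.
  by congr (p (clamp _)); lra.
Qed.

Lemma homotopic_in_revl S p : path_in S p ->
  homotopic_in S (path_concat (path_rev p) p) (fun=> p one).
Proof.
move=> Sp; have := homotopic_in_revr (path_in_rev Sp).
by rewrite path_revK path_rev0.
Qed.

(** Going out and back along [q] in the middle of a path changes nothing; this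
    is how chains of detours through a common point telescope. *)
Lemma homotopic_in_cancel S p q r : path_in S p -> path_in S q -> path_in S r ->
  p one = q zero -> p one = r zero ->
  homotopic_in S (path_concat (path_concat p q) (path_concat (path_rev q) r))
    (path_concat p r).
Proof.
move=> Sp Sq Sr pq pr.
have Sq' := path_in_rev Sq.
have qr : path_rev q one = r zero by rewrite path_rev1 -pq.
have Sqr : path_in S (path_concat (path_rev q) r) by exact: path_in_concat.
apply: (homotopic_in_trans (q := path_concat p (path_concat q (path_concat (path_rev q) r)))).
  by apply: homotopic_in_assoc => //; rewrite path_concat0 path_rev0.
apply: homotopic_in_concat; [by rewrite path_concat0|exact: homotopic_in_refl|].
apply: (homotopic_in_trans (q := path_concat (path_concat q (path_rev q)) r)).
  by apply: homotopic_in_sym; apply: homotopic_in_assoc => //; rewrite path_rev0.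
apply: (homotopic_in_trans (q := path_concat (fun=> q zero) r)).
  apply: homotopic_in_concat; last exact: homotopic_in_refl.
    by rewrite path_concat1.
  exact: homotopic_in_revr.
by rewrite -pq pr; exact: homotopic_in_cstl.
Qed.

End PathHomotopy.

Lemma homotopic_in_comp (R : realType) (A B : topologicalType) (S : set A)
    (S' : set B) (f : A -> B) (p q : unit_interval R -> A) :
  (forall x, S x -> {for x, continuous f}) -> (forall x, S x -> S' (f x)) ->
  homotopic_in S p q -> homotopic_in S' (f \o p) (f \o q).
Proof.
move=> cf SS' [H [cH H01 He SH]]; exists (f \o H); split.
- by move=> z; apply: (@continuous_comp _ _ _ H f); [exact: cH|exact: cf].
- by move=> t /=; rewrite (H01 t).1 (H01 t).2.
- by move=> t /=; rewrite (He t).1 (He t).2.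
- by move=> z; exact: SS'.
Qed.

Section UnitIntervalTopology.
Context {R : realType}.
Local Notation I := (unit_interval R).

Lemma range_clamp : clamp @` `[0, 1]%classic = [set: I].
Proof.
apply/seteqP; split=> // t _; exists (\val t); last exact: valK_clamp.
by rewrite /= in_itv /= val_ge0 val_le1.
Qed.

Lemma unit_interval_connected : connected [set: I].
Proof.
rewrite -range_clamp; apply: connected_continuous_connected.
  exact: segment_connected.
exact/continuous_subspaceT/clamp_continuous.
Qed.

Lemma unit_interval_compact : compact [set: I].
Proof.
rewrite -range_clamp; apply: continuous_compact; last exact: segment_compact.
exact/continuous_subspaceT/clamp_continuous.
Qed.

Lemma unit_interval_near (x : I) (A : set I) : nbhs x A ->
  exists2 e : R, 0 < e & forall t : I, `|\val t - \val x| < e -> A t.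
Proof.
move=> xA; have : nbhs (\val x) (clamp @^-1` A).
  by apply: clamp_continuous; rewrite valK_clamp.
move=> /nbhs_ballP[e /= e0 eA]; exists e => // t te.
by have := eA (\val t); rewrite /= valK_clamp; apply; rewrite /ball /= distrC.
Qed.

Lemma unit_interval_ball (x : I) (e : R) : 0 < e ->
  nbhs x [set t : I | `|\val x - \val t| < e].
Proof.
move=> e0; have xe : nbhs (\val x : R) (ball (\val x : R) e) by exact: nbhsx_ballx.
exact: (@val_continuous R x _ xe).
Qed.

(** Induction by bisection: what holds for short paths and survives joining two
    halves holds for all paths, since by compactness finitely many bisections
    make all pieces short. *)
Theorem path_bisection {T : topologicalType} (cover : set T -> Prop)
    (P : (I -> T) -> Prop) :
  (forall p V, continuous p -> cover V -> (forall t, V (p t)) -> P p) ->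
  (forall p, continuous p -> P (first_half p) -> P (second_half p) -> P p) ->
  forall p, continuous p -> (forall t, exists2 V, cover V & nbhs (p t) V) -> P p.
Proof.
move=> Psmall Pjoin p cp pV.
have [k] : exists k : nat, forall x : I, exists2 V, cover V &
    forall t : I, `|\val t - \val x| <= 2^-1 ^+ k -> V (p t).
  have := unit_interval_compact; rewrite compact_near_coveringP => nc.
  have := nc nat \oo (fun (k : nat) (x : I) => exists2 V, cover V &
    forall t : I, `|\val t - \val x| <= 2^-1 ^+ k -> V (p t)) _.
  case.
    move=> x _; have [V cV xV] := pV x; have /unit_interval_near[e e0 eV] := cp x _ xV.
    have xn := @unit_interval_ball x (e / 2) (divr_gt0 e0 (ltr0Sn _ 1)).
    have kn : \forall k \near \oo, 2^-1 ^+ k < e / 2 :> R.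
      near=> k.
      have : `|2^-1 ^+ k : R| < e / 2.
        near: k; have /cvgr0_norm_lt : (fun k => 2^-1 ^+ k : R^o) @ \oo --> (0 : R^o).
          apply: cvg_expr; rewrite ger0_norm; lra.
        by apply; lra.
      by apply: le_lt_trans; exact: ler_norm.
    exists ([set x' : I | `|\val x - \val x'| < e / 2], [set k | 2^-1 ^+ k < e / 2]) => //.
    move=> [x' k] /= [x'e ke]; exists V => // t tx'; apply: eV.
    rewrite -(subrKA (\val x')) (le_lt_trans (ler_normD _ _)) //.
    by rewrite (splitr e) ltrD // ?(le_lt_trans tx') // distrC.
  by move=> k _ kP; exists k => x; exact: (kP k (leqnn k) x).
(* The bound on [k] is uniform in the point, so it passes to both halves with
   [k] decreased by one. *)
elim: k p cp {pV} => [|k IHk] p cp kP.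
  have [V cV VP] := kP zero; apply: (Psmall p V) => // t; apply: VP.
  by rewrite expr0 val_zero subr0 ger0_norm ?val_ge0 // val_le1.
have half (a b : R) (q : I -> T) : 0 <= b <= 1 / 2 ->
    q = (fun t => p (clamp (1 / 2 * \val t + b))) -> P q.
  move=> b01 ->; apply: IHk.
    apply: continuous_comp_fun cp; apply: continuous_clamp_comp.
    exact: continuous_affine_val.
  move=> x; have x0 := val_ge0 x; have x1 := val_le1 x.
  have [V cV VP] := kP (clamp (1 / 2 * \val x + b)); exists V => // t tx.
  have t0 := val_ge0 t; have t1 := val_le1 t.
  apply: VP; rewrite !val_clamp; [|apply/andP; split; lra|apply/andP; split; lra].
  have -> : 1 / 2 * \val t + b - (1 / 2 * \val x + b) = 2^-1 * (\val t - \val x) by lra.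
  by rewrite normrM exprS ler_pM // ger0_norm // invr_ge0.
apply: Pjoin => //; first by apply: (half 0 0) => //; apply/andP; split; lra.
by apply: (half 0 (1 / 2)) => //; apply/andP; split; lra.
Unshelve. all: by end_near.
Qed.

End UnitIntervalTopology.

(** * Homotopy invariance from local data *)

Lemma continuous_pair (S A B : topologicalType) (f : S -> A) (g : S -> B) :
  continuous f -> continuous g -> continuous (fun z => (f z, g z)).
Proof. by move=> cf cg z; apply: cvg_pair; [exact: cf|exact: cg]. Qed.

Section Connected.

Lemma connected_locally_constant (T : topologicalType) (C : T -> Prop) :
  connected [set: T] -> (forall x, \forall y \near x, C y <-> C x) ->
  forall x y, C x -> C y.
Proof.
move=> cT locC x y Cx; suff : [set z | C z] = setT by move/seteqP => [_ /(_ y)]; apply.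
apply: cT; first by exists x.
- exists [set z | C z]; last by rewrite setTI.
  rewrite openE => z Cz; have := locC z; apply: filterS => w [_]; exact.
- exists [set z | C z]; last by rewrite setTI.
  rewrite -openC openE => z Cz; have := locC z; apply: filterS => w [wz _] /wz.
  exact: Cz.
Qed.

End Connected.

Section HomotopyInvariance.
Context {R : realType} {M : topologicalType}.
Local Notation I := (unit_interval R).
Variables (U : set M) (E : (I -> M) -> (I -> M) -> Prop).

(** What is required of an equivalence [E] on paths in [U] to be handled like
    homotopy when squares of paths are pasted.  Reparametrisations fix both ends,
    so that a lift of a path is reparametrised along with it. *)
Record path_congruence : Prop := PathCongruence {
  path_congr_sym : forall p q, path_in U p -> path_in U q -> E p q -> E q p;
  path_congr_trans : forall p q r, path_in U p -> path_in U q -> path_in U r ->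
    E p q -> E q r -> E p r;
  path_congr_concat : forall p p' q q', path_in U p -> path_in U p' ->
    path_in U q -> path_in U q' -> p one = q zero -> p' one = q' zero ->
    E p p' -> E q q' -> E (path_concat p q) (path_concat p' q');
  path_congr_reparam : forall p phi, path_in U p -> reparam phi -> E p (p \o phi)
}.

(** Inside [V], the trace of [U] looks simply connected as far as [E] can see. *)
Definition good (V : set M) : Prop :=
  [/\ open V, V `&` U !=set0,
      forall a b, (V `&` U) a -> (V `&` U) b ->
        exists p : I -> M, [/\ path_in (V `&` U) p, p zero = a & p one = b]
    & forall p q, path_in (V `&` U) p -> path_in (V `&` U) q ->
        p zero = q zero -> p one = q one -> E p q].

Definition locally_good : Prop :=
  forall x N, nbhs x N -> exists V, [/\ good V, V x & V `<=` N].

(** Neighbourhoods of the graph play the role of uniform neighbourhoods of the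
    path [g]. *)
Definition tube (Om : set (I * M)) (g : I -> M) : Prop :=
  forall t, nbhs (t, g t) Om.

Hypothesis Econgr : path_congruence.
Hypothesis Mgood : locally_good.

(** Bisection yields approximations in [U] of any path of [M]: a short piece lies
    in a good set, where [U] is path connected, and two pieces are joined at a
    point of [U] near the common end.  For this the endpoints of the
    approximation must be free to vary in neighbourhoods.  Bisection is applied
    to the graph of [g], so that short pieces lie in boxes inside the tube. *)
Lemma path_in_tube (g : I -> M) (Om : set (I * M)) :
  continuous g -> tube Om g -> U (g zero) -> U (g one) ->
  exists u, [/\ path_in U u, u zero = g zero, u one = g one & forall t, Om (t, u t)].
Proof.
move=> cg tg U0 U1.
pose cover (W : set (I * M)) := exists A V, [/\ good V, W = A `*` V & W `<=` Om].
pose P (G : I -> I * M) := exists O O', [/\ nbhs (G zero).2 O, nbhs (G one).2 O' &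
  forall a b, O a -> U a -> O' b -> U b ->
  exists u, [/\ path_in U u, u zero = a, u one = b & forall t, Om ((G t).1, u t)]].
have : P (fun t => (t, g t)).
  apply: (@path_bisection R _ cover).
  - move=> G W cG [A [V [gV -> VOm]]] GV; have [oV _ pV _] := gV.
    exists V, V; split.
    + by apply: open_nbhs_nbhs; split=> //; case: (GV zero).
    + by apply: open_nbhs_nbhs; split=> //; case: (GV one).
    move=> a b Va Ua Vb Ub; have [//|//|u [uV u0 u1]] := pV a b.
    exists u; split=> //; first by apply: path_inS uV => z [].
    by move=> t; apply: VOm; split; [case: (GV t)|case: (uV.2 t)].
  - move=> G cG [O1 [O1' [n1 n1' G1]]] [O2 [O2' [n2 n2' G2]]].
    exists O1, O2'; split; [by rewrite -first_half0|by rewrite -second_half1|].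
    move=> a b Oa Ua Ob Ub.
    have [V [[_ [m [Vm Um]] _ _] _ VO]] : exists V, [/\ good V,
        V (second_half G zero).2 & V `<=` O1' `&` O2].
      by apply: Mgood; apply: filterI => //; rewrite -first_half1.
    have [O1m O2m] := VO _ Vm.
    have [u [uU u0 u1 uOm]] := G1 a m Oa Ua O1m Um.
    have [v [vU v0 v1 vOm]] := G2 m b O2m Um Ob Ub.
    exists (path_concat u v); split.
    + by apply: path_in_concat => //; rewrite u1.
    + by rewrite path_concat0.
    + by rewrite path_concat1.
    + by move=> t; rewrite -(concat_halves G) /path_concat; case: ifP.
  - by apply: continuous_pair => // t; exact: cvg_id.
  - move=> t; have [[A B] /= [tA gB] AB] := tg t.
    have [V [gV Vx VB]] := Mgood gB.
    have [oV _ _ _] := gV.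
    exists (A `*` V).
      exists A, V; split=> //; apply: subset_trans AB => -[s y] [/= As Vy].
      by split=> //; exact: VB.
    by exists (A, V) => //; split=> //; exact: open_nbhs_nbhs.
move=> [O [O' [On On' OU]]].
exact: OU (nbhs_singleton On) U0 (nbhs_singleton On') U1.
Qed.

Let Esym := path_congr_sym Econgr.
Let Etrans := path_congr_trans Econgr.
Let Econcat := path_congr_concat Econgr.

Let Erefl p : path_in U p -> E p p.
Proof.
move=> Up; apply: (path_congr_reparam Econgr (phi := id)) => //; split=> // t.
exact: cvg_id.
Qed.

Let Eassoc p q r : path_in U p -> path_in U q -> path_in U r ->
  p one = q zero -> q one = r zero ->
  E (path_concat p (path_concat q r)) (path_concat (path_concat p q) r).
Proof.
move=> Up Uq Ur pq qr; have [phi rphi ->] := concat_assoc_reparam p q r.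
apply: (path_congr_reparam Econgr) => //.
by apply: path_in_concat => //; [exact: path_in_concat|rewrite path_concat0].
Qed.

(* The condition at the single time [one] still gives a tube, as it constrains
   no other fibre. *)
Let tube_endpoint (V V' : set M) (g : I -> M) : continuous g -> open V -> open V' ->
  (forall t, V (g t)) -> V' (g one) ->
  tube [set z | V z.2 /\ (z.1 = one -> V' z.2)] g.
Proof.
move=> cg oV oV' Vg V'g t.
have nV x : V x -> nbhs x V by move=> Vx; exact: open_nbhs_nbhs.
have nV' x : V' x -> nbhs x V' by move=> Vx; exact: open_nbhs_nbhs.
have [->|t1] := eqVneq t one.
  exists (setT, V `&` V') => /=; last by move=> [s y] [_ []].
  by split; [exact: filterT|apply: filterI; [exact: nV|exact: nV']].
have tlt : 0 < 1 - \val t.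
  rewrite subr_gt0 lt_neqAle val_le1 andbT; apply: contra_neq t1 => t1.
  by apply: val_inj; rewrite t1 val_one.
exists ([set s : I | `|\val t - \val s| < 1 - \val t], V) => /=.
  by split; [exact: unit_interval_ball|exact: nV].
move=> [s y] /= [ts Vy]; split=> // s1; move: ts; rewrite s1 val_one.
by rewrite distrC (ger0_norm (ltW tlt)) ltxx.
Qed.

Let tube_concat (Om1 Om2 : set (I * M)) (g : I -> M) : continuous g ->
  tube Om1 (first_half g) -> tube Om2 (second_half g) ->
  tube [set z | (\val z.1 <= 1 / 2 -> Om1 (clamp (2 * \val z.1 + 0), z.2)) /\
                (1 / 2 <= \val z.1 -> Om2 (clamp (2 * \val z.1 + -1), z.2))] g.
Proof.
move=> cg t1 t2 t; have t_0 := val_ge0 t; have t_1 := val_le1 t.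
have pull (k l : R) (Om : set (I * M)) (e : I) : e = clamp (k * \val t + l) ->
    nbhs (e, g t) Om -> nbhs (t, g t) [set z | Om (clamp (k * \val z.1 + l), z.2)].
  move=> -> Omt.
  have c : {for (t, g t),
      continuous (fun z : I * M => (clamp (k * \val z.1 + l), z.2))}.
    apply: continuous_pair; last exact: continuous_snd.
    have cz : continuous (fun z : I * M => \val z.1 : R).
      by apply: continuous_comp_fun (@val_continuous R); exact: continuous_fst.
    by apply: continuous_clamp_affine; exact: cz.
  exact: c.
have away (e : R) (b : bool) : 0 < e ->
    (if b then e = \val t - 1 / 2 else e = 1 / 2 - \val t) ->
    nbhs (t, g t) [set z | if b then 1 / 2 < \val z.1 else \val z.1 < 1 / 2].
  move=> e0 eb; exists ([set s : I | `|\val t - \val s| < e], setT).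
    by split; [exact: unit_interval_ball|exact: filterT].
  move=> [s y] /= [ts _]; move: ts; rewrite ltr_norml => /andP[? ?].
  by case: b eb => /= ?; lra.
apply: filterI.
  have [tle|tgt] := leP (\val t) (1 / 2).
    apply: filterS (pull 2 0 Om1 (clamp (2 * \val t + 0)) erefl _) => //.
    have := t1 (clamp (2 * \val t + 0)); rewrite /first_half.
    rewrite val_clamp; last by apply/andP; split; lra.
    rewrite (_ : 1 / 2 * (2 * \val t + 0) + 0 = \val t); last by lra.
    by rewrite valK_clamp.
  have e0 : 0 < \val t - 1 / 2 by lra.
  apply: filterS (away _ true e0 erefl) => z /= z1 z2; exfalso; lra.
have [tle|tgt] := leP (1 / 2) (\val t).
  apply: filterS (pull 2 (-1) Om2 (clamp (2 * \val t + -1)) erefl _) => //.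
  have := t2 (clamp (2 * \val t + -1)); rewrite /second_half.
  rewrite val_clamp; last by apply/andP; split; lra.
  rewrite (_ : 1 / 2 * (2 * \val t + -1) + 1 / 2 = \val t); last by lra.
  by rewrite valK_clamp.
have e0 : 0 < 1 / 2 - \val t by lra.
apply: filterS (away _ false e0 erefl) => z /= z1 z2; exfalso; lra.
Qed.

(** Uniqueness of approximations in [U] is proved by bisection too.  The bisected
    statement is about two approximations [u] and [v] with different endpoints: a
    path [c] joining their starts can be carried along to a path [c'] joining
    their ends so that the square commutes up to [E].  The quantifiers over
    neighbourhoods run from the end to the start, which is what makes the squares
    over the two halves composable. *)
Lemma congruent_in_tube (g : I -> M) : continuous g ->
  exists2 Om, tube Om g & forall u v, path_in U u -> path_in U v ->
    (forall t, Om (t, u t)) -> (forall t, Om (t, v t)) ->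
    u zero = g zero -> v zero = g zero -> u one = g one -> v one = g one -> E u v.
Proof.
move=> cg.
pose P (g : I -> M) := forall O', nbhs (g one) O' -> exists O Om,
  [/\ nbhs (g zero) O, tube Om g & forall u v c, path_in U u -> path_in U v ->
    (forall t, Om (t, u t)) -> (forall t, Om (t, v t)) ->
    path_in (O `&` U) c -> c zero = u zero -> c one = v zero ->
    exists c', [/\ path_in (O' `&` U) c', c' zero = u one, c' one = v one &
      E (path_concat u c') (path_concat c v)]].
have Pg : P g.
  apply: (@path_bisection R _ good) => //.
  - move=> p V cp gV Vp O' nO'; have [oV _ pV eV] := gV.
    have [V' [gV' V'p V'O]] : exists V', [/\ good V', V' (p one) & V' `<=` O' `&` V].
      by apply: Mgood; apply: filterI => //; exact: open_nbhs_nbhs.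
    have [oV' _ pV' _] := gV'.
    exists V, [set z | V z.2 /\ (z.1 = one -> V' z.2)]; split.
    + exact: open_nbhs_nbhs.
    + exact: tube_endpoint.
    move=> u v c Uu Uv Omu Omv cV c0 c1.
    have [| |c' [c'V' c'0 c'1]] := pV' (u one) (v one).
    + by split; [exact: (Omu one).2|exact: Uu.2].
    + by split; [exact: (Omv one).2|exact: Uv.2].
    have uV : path_in (V `&` U) u.
      by split; [exact: Uu.1|move=> t; split; [exact: (Omu t).1|exact: Uu.2]].
    have vV : path_in (V `&` U) v.
      by split; [exact: Uv.1|move=> t; split; [exact: (Omv t).1|exact: Uv.2]].
    exists c'; split=> //.
      by apply: path_inS c'V' => z [V'z Uz]; split=> //; exact: (V'O _ V'z).1.
    apply: eV.
    + apply: path_in_concat => //; apply: path_inS c'V' => z [V'z Uz]; split=> //.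
      exact: (V'O _ V'z).2.
    + exact: path_in_concat.
    + by rewrite !path_concat0.
    + by rewrite !path_concat1.
  - move=> p cp P1 P2 O'; rewrite -second_half1 => /P2[Om [Om2 [n2 t2 E2]]].
    have [|O [Om1 [n1 t1 E1]]] := P1 Om; first by rewrite first_half1.
    exists O, [set z | (\val z.1 <= 1 / 2 -> Om1 (clamp (2 * \val z.1 + 0), z.2)) /\
                (1 / 2 <= \val z.1 -> Om2 (clamp (2 * \val z.1 + -1), z.2))]; split.
    + by rewrite -first_half0.
    + exact: tube_concat.
    have half (u : I -> M) : (forall t : I,
        (\val t <= 1 / 2 -> Om1 (clamp (2 * \val t + 0), u t)) /\
        (1 / 2 <= \val t -> Om2 (clamp (2 * \val t + -1), u t))) ->
        (forall t, Om1 (t, first_half u t)) /\ (forall t, Om2 (t, second_half u t)).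
      move=> h; split=> t; have t_0 := val_ge0 t; have t_1 := val_le1 t.
        have [+ _] := h (clamp (1 / 2 * \val t + 0)).
        rewrite val_clamp; last by apply/andP; split; lra.
        rewrite (_ : 2 * (1 / 2 * \val t + 0) + 0 = \val t); last by lra.
        by rewrite valK_clamp; apply; lra.
      have [_ +] := h (clamp (1 / 2 * \val t + 1 / 2)).
      rewrite val_clamp; last by apply/andP; split; lra.
      rewrite (_ : 2 * (1 / 2 * \val t + 1 / 2) + -1 = \val t); last by lra.
      by rewrite valK_clamp; apply; lra.
    move=> u v c Uu Uv /half[u1 u2] /half[v1 v2] cO c0 c1.
    have Uu1 := path_in_first Uu; have Uu2 := path_in_second Uu.
    have Uv1 := path_in_first Uv; have Uv2 := path_in_second Uv.
    have [| |m [mO m0 m1 Em]] := E1 _ _ c Uu1 Uv1 u1 v1 cO; rewrite ?first_half0 //.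
    rewrite !first_half1 in m0 m1.
    have [c' [c'O c'0 c'1 Ec]] := E2 _ _ m Uu2 Uv2 u2 v2 mO m0 m1.
    rewrite !second_half1 in c'0 c'1.
    exists c'; split=> //.
    have Uc : path_in U c by apply: path_inS cO => z [].
    have Um : path_in U m by apply: path_inS mO => z [].
    have Uc' : path_in U c' by apply: path_inS c'O => z [].
    rewrite -[u]concat_halves -[v]concat_halves.
    have := first_half1 u; have := first_half1 v.
    have := second_half1 u; have := second_half1 v.
    have := first_half0 u; have := first_half0 v.
    move: (first_half u) (second_half u) (first_half v) (second_half v)
      Uu1 Uu2 Uv1 Uv2 Em Ec m0 m1.
    move=> a b a' b' Ua Ub Ua' Ub' Em Ec m0 m1 a'0 a0 b'1 b1 aa' ab.
    have Ubc : path_in U (path_concat b c') by apply: path_in_concat => //; rewrite b1 c'0.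
    have Umb : path_in U (path_concat m b') by apply: path_in_concat.
    have Uam : path_in U (path_concat a m) by apply: path_in_concat => //; rewrite m0 ab.
    have Uca : path_in U (path_concat c a') by apply: path_in_concat => //; rewrite c1 a'0.
    have U1 : path_in U (path_concat (path_concat a b) c').
      by apply: path_in_concat => //; [apply: path_in_concat|rewrite path_concat1 b1 c'0].
    have U2 : path_in U (path_concat a (path_concat b c')).
      by apply: path_in_concat => //; rewrite path_concat0.
    have U3 : path_in U (path_concat a (path_concat m b')).
      by apply: path_in_concat => //; rewrite path_concat0 m0.
    have U4 : path_in U (path_concat (path_concat a m) b').
      by apply: path_in_concat => //; rewrite path_concat1.
    have U5 : path_in U (path_concat (path_concat c a') b').
      by apply: path_in_concat => //; rewrite path_concat1.
    have U6 : path_in U (path_concat c (path_concat a' b')).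
      by apply: path_in_concat => //; [apply: path_in_concat|rewrite path_concat0 c1 a'0].
    (* (ab)c' = a(bc') = a(mb') = (am)b' = (ca')b' = c(a'b'). *)
    apply: (Etrans U1 U2 U6).
      by apply: Esym => //; apply: Eassoc => //; rewrite b1 c'0.
    apply: (Etrans U2 U3 U6).
      by apply: Econcat => //; rewrite ?path_concat0 ?m0 //; exact: Erefl.
    apply: (Etrans U3 U4 U6); first by apply: Eassoc => //; rewrite m0.
    apply: (Etrans U4 U5 U6).
      by apply: Econcat => //; rewrite ?path_concat1 //; exact: Erefl.
    by apply: Esym => //; apply: Eassoc => //; rewrite c1 a'0.
  - move=> t; have [V [gV Vt _]] := Mgood (@filterT _ (nbhs (g t)) _).
    by exists V => //; have [oV _ _ _] := gV; exact: open_nbhs_nbhs.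
have [V0 [gV0 V0g _]] := Mgood (@filterT _ (nbhs (g one)) _).
have [oV0 _ _ eV0] := gV0.
have [|O [Om [nO tOm EOm]]] := Pg V0; first exact: open_nbhs_nbhs.
exists Om => // u v Uu Uv Omu Omv u0 v0 u1 v1.
have Ug0 : U (g zero) by rewrite -u0; exact: Uu.2.
have Ug1 : U (g one) by rewrite -u1; exact: Uu.2.
have cO : path_in (O `&` U) (fun _ : I => g zero).
  by apply: path_in_cst; split=> //; exact: nbhs_singleton nO.
have [| |c' [c'V c'0 c'1 Ec]] := EOm u v _ Uu Uv Omu Omv cO; rewrite ?u0 ?v0 //.
have kV : path_in (V0 `&` U) (fun _ : I => g one) by exact: path_in_cst.
have Uk : path_in U (fun _ : I => g one) by exact: path_in_cst.
have Uk0 : path_in U (fun _ : I => g zero) by exact: path_in_cst.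
have Uc' : path_in U c' by apply: path_inS c'V => z [].
have Uuk : path_in U (path_concat u (fun _ : I => g one)) by apply: path_in_concat.
have Uuc : path_in U (path_concat u c') by apply: path_in_concat.
have Ukv : path_in U (path_concat (fun _ : I => g zero) v) by apply: path_in_concat.
apply: (Etrans Uu Uuk Uv).
  have [phi rphi e] := concat_cstr_reparam u.
  by rewrite -u1 e; exact: (path_congr_reparam Econgr).
apply: (Etrans Uuk Uuc Uv).
  apply: Econcat => //; first exact: Erefl.
  by apply: eV0 => //; rewrite ?c'0 ?c'1 ?u1 ?v1.
apply: (Etrans Uuc Ukv Uv) => //.
apply: Esym => //; have [phi rphi e] := concat_cstl_reparam v.
by rewrite -v0 e; exact: (path_congr_reparam Econgr).
Qed.

Let tube_near (H : I * I -> M) (Om : set (I * M)) (s : I) : continuous H ->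
  tube Om (fun t => H (t, s)) -> \forall s' \near s, tube Om (fun t => H (t, s')).
Proof.
move=> cH tOm; have := @unit_interval_compact R; rewrite compact_near_coveringP => nc.
have nP : \forall s' \near s, [set: I] `<=` [set t | nbhs (t, H (t, s')) Om].
  apply: (nc I (nbhs s) (fun s' t => nbhs (t, H (t, s')) Om) (@nbhs_filter I s)) => t _.
  have c : {for (t, s), continuous (fun z : I * I => (z.1, H z))}.
    by apply: continuous_pair => //; exact: continuous_fst.
  have : nbhs (t, s) [set z : I * I | nbhs (z.1, H z) Om].
    by apply: (c [set w | nbhs w Om]); apply: nbhs_interior; exact: tOm.
  by apply: filterS => -[].
by apply: filterS nP => s' sP t; exact: sP.
Qed.

(** A homotopy in [M] between paths in [U] forces [E], although it may leave [U].
    Each stage of the homotopy has approximations in [U], unique up to [E] near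
    the stage, and a tube around one stage is a tube around all nearby stages; so
    whether the approximations are [E]-equivalent to [p] is locally constant. *)
Theorem homotopic_congruent (p q : I -> M) : path_in U p -> path_in U q ->
  homotopic_in setT p q -> E p q.
Proof.
move=> Up Uq [H [cH H01 He _]].
have cHs s : continuous (fun t => H (t, s)) by exact: continuous_pairl.
pose C s := forall Om, tube Om (fun t => H (t, s)) ->
  exists u, [/\ path_in U u, u zero = p zero, u one = p one,
                forall t, Om (t, u t) & E p u].
have H0 : (fun t => H (t, zero)) = p by apply/funext => t; rewrite (H01 t).1.
have H1 : (fun t => H (t, one)) = q by apply/funext => t; rewrite (H01 t).2.
have C0 : C zero.
  move=> Om; rewrite H0 => tOm; exists p; split=> //; last exact: Erefl.
  by move=> t; exact: nbhs_singleton (tOm t).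
have C1 : C one.
  apply: (connected_locally_constant (@unit_interval_connected R)) C0 => s.
  have [Om tOm EOm] := congruent_in_tube (cHs s).
  have two s1 s2 : tube Om (fun t => H (t, s1)) -> tube Om (fun t => H (t, s2)) ->
      C s1 -> C s2.
    move=> ts1 ts2 Cs1 Om' tOm'.
    have [u [Uu u0 u1 Omu Eu]] := Cs1 _ ts1.
    have tI : tube (Om `&` Om') (fun t => H (t, s2)) by move=> t; exact: filterI.
    have [||v [Uv v0 v1 Omv]] := path_in_tube (cHs s2) tI.
    + by rewrite (He s2).1; exact: Up.2.
    + by rewrite (He s2).2; exact: Up.2.
    rewrite (He s2).1 in v0; rewrite (He s2).2 in v1.
    exists v; split=> //; first by move=> t; case: (Omv t).
    apply: (Etrans Up Uu Uv Eu); apply: EOm => //.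
    + by move=> t; case: (Omv t).
    + by rewrite u0 (He s).1.
    + by rewrite v0 (He s).1.
    + by rewrite u1 (He s).2.
    + by rewrite v1 (He s).2.
  apply: filterS (tube_near cH tOm) => s' ts'.
  by split; apply: two.
have [Om tOm EOm] := congruent_in_tube (cHs one).
have [u [Uu u0 u1 Omu Eu]] := C1 _ tOm.
apply: (Etrans Up Uu Uq Eu); apply: EOm => //.
- move=> t; rewrite -[q]H1; exact: nbhs_singleton (tOm t).
- by rewrite u0 (He one).1.
- by rewrite -[q]H1.
- by rewrite u1 (He one).2.
- by rewrite -[q]H1.
Qed.

End HomotopyInvariance.

(** * Finite products and straight-line homotopies *)

Section FiniteProduct.
Context {n : nat} {K : topologicalType}.
Local Notation M := (prod_topology (fun _ : 'I_n => K)).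

Lemma filter_forall_fin (J : finType) (T : Type) (F : set_system T) (P : J -> set T) :
  Filter F -> (forall i, F (P i)) -> F [set x | forall i, P i x].
Proof.
move=> FF FP.
have : forall s : seq J, F [set x | forall i, i \in s -> P i x].
  elim=> [|j s IHs]; first by apply: filterS filterT => x _ i.
  apply: filterS (filterI (FP j) IHs) => x [Pjx Ps] i.
  by rewrite inE => /orP[/eqP ->|/Ps].
move=> /(_ (enum J)); apply: filterS => x Px i.
by apply: Px; rewrite mem_enum.
Qed.

Lemma continuous_coord (i : 'I_n) : continuous (fun y : M => y i).
Proof. exact: (@proj_continuous 'I_n (fun _ => K) i). Qed.

Lemma cvg_prod_topology (F : set_system M) (p : M) : Filter F ->
  (forall i, (fun y : M => y i) @ F --> p i) -> F --> p.
Proof.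
move=> FF Fp; apply/cvg_sup => i A [B [[W oW <-] Wp] BA].
by apply: filterS BA _; apply: Fp; exact: open_nbhs_nbhs.
Qed.

Lemma continuous_at_prod (T : topologicalType) (f : T -> M) (x : T) :
  (forall i, {for x, continuous (fun z => f z i)}) -> {for x, continuous f}.
Proof. by move=> cf; apply: cvg_prod_topology => i; exact: cf. Qed.

Lemma continuous_to_prod (T : topologicalType) (f : T -> M) :
  (forall i, continuous (fun x => f x i)) -> continuous f.
Proof.
by move=> cf x; apply: continuous_at_prod => i; exact: cf.
Qed.

Lemma nbhs_box (p : M) (O : 'I_n -> set K) :
  (forall i, nbhs (p i) (O i)) -> nbhs p [set q : M | forall i, O i (q i)].
Proof.
move=> nO; apply: filter_forall_fin => i.
by apply: (@continuous_coord i p); exact: nO.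
Qed.

(** Boxes form a basis, as only finitely many coordinates are involved: their
    filter converges to [p] coordinatewise. *)
Lemma nbhs_prodP (p : M) (N : set M) : nbhs p N ->
  exists2 O : 'I_n -> set K, forall i, nbhs (p i) (O i) &
    [set q : M | forall i, O i (q i)] `<=` N.
Proof.
pose G : set_system M := [set A | exists2 O : 'I_n -> set K,
  forall i, nbhs (p i) (O i) & [set q : M | forall i, O i (q i)] `<=` A].
have FG : Filter G.
  split.
  - by exists (fun=> setT) => // i; exact: filterT.
  - move=> A B [O nO OA] [O' nO' OB]; exists (fun i => O i `&` O' i).
      by move=> i; exact: filterI.
    by move=> q qO; split; [apply: OA => i|apply: OB => i]; case: (qO i).
  - move=> A B AB [O nO OA]; exists O => //; exact: subset_trans AB.
suff : G --> p by move=> /(_ N).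
apply: cvg_prod_topology => i A nA.
exists (fun j => [set y | j = i -> A y]).
  move=> j; have [->|ji] := eqVneq j i; first by apply: filterS nA => y Ay _.
  by apply: filterS filterT => y _ /eqP; rewrite (negbTE ji).
by move=> q /(_ i); exact.
Qed.

End FiniteProduct.

Section LinearComplement.
Context {R : realType} {n d : nat}.
Local Notation I := (unit_interval R).
Local Notation V := ('rV[R]_d).
Local Notation M := (prod_topology (fun _ : 'I_n => V)).

Definition segment (a b : M) : I -> M :=
  fun t i => (1 - \val t) *: a i + \val t *: b i.

Lemma segment0 a b : segment a b zero = a.
Proof. by apply/funext => i; rewrite /segment val_zero subr0 scale1r scale0r addr0. Qed.

Lemma segment1 a b : segment a b one = b.
Proof. by apply/funext => i; rewrite /segment val_one subrr scale1r scale0r add0r. Qed.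

Lemma path_rev_segment a b : path_rev (segment a b) = segment b a.
Proof.
apply/funext => t; apply/funext => i; have t0 := val_ge0 t; have t1 := val_le1 t.
rewrite /path_rev /segment val_clamp; last by apply/andP; split; lra.
by rewrite addrC; congr (_ *: _ + _ *: _); lra.
Qed.

Lemma continuous_lincomb (T : topologicalType) (k l : T -> R) (f g : T -> V) :
  continuous k -> continuous l -> continuous f -> continuous g ->
  continuous (fun z => k z *: f z + l z *: g z).
Proof.
move=> ck cl cf cg z; apply: cvgD; apply: cvgZ; [exact: ck|exact: cf|exact: cl|exact: cg].
Qed.

Lemma continuous_lincomb_prod (T : topologicalType) (k l : T -> R) (f g : T -> M) :
  continuous k -> continuous l -> continuous f -> continuous g ->
  continuous (fun z => (fun i => k z *: f z i + l z *: g z i) : M).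
Proof.
move=> ck cl cf cg; apply: continuous_to_prod => i; apply: continuous_lincomb => //.
  exact: (continuous_comp_fun cf (@continuous_coord _ _ i)).
exact: (continuous_comp_fun cg (@continuous_coord _ _ i)).
Qed.

Let continuous_1B (T : topologicalType) (k : T -> R) :
  continuous k -> continuous (fun z => 1 - k z).
Proof. by move=> ck z; apply: cvgB; [exact: cvg_cst|exact: ck]. Qed.

Lemma segment_continuous a b : continuous (segment a b).
Proof.
have cv := @val_continuous R.
apply: continuous_lincomb_prod; [exact: continuous_1B|exact: cv| |];
  exact: cst_continuous.
Qed.

Lemma homotopic_straight (S : set M) (p q : I -> M) :
  continuous p -> continuous q -> p zero = q zero -> p one = q one ->
  (forall s t, S (segment (p t) (q t) s)) -> homotopic_in S p q.
Proof.
move=> cp cq pq0 pq1 Spq; exists (fun z => segment (p z.1) (q z.1) z.2); split.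
- have cv := @continuous_valsnd R.
  apply: continuous_lincomb_prod; [exact: continuous_1B|exact: cv| |].
    exact: (continuous_comp_fun (@continuous_fst _ _) cp).
  exact: (continuous_comp_fun (@continuous_fst _ _) cq).
- by move=> t; rewrite segment0 segment1.
- have seg_id a s : segment a a s = a.
    by apply/funext => i; rewrite /segment -scalerDl subrK scale1r.
  by move=> s /=; rewrite -pq0 -pq1 !seg_id.
- by move=> z; exact: Spq.
Qed.

Definition in_triangle (a b c y : M) : Prop := exists k l m : R,
  [/\ 0 <= k, 0 <= l, 0 <= m, k + l + m = 1 &
      y = (fun i => k *: a i + l *: b i + m *: c i) :> M].

(** The straight-line homotopy from the segment to the detour through [c] stays
    in the triangle. *)
Lemma homotopic_triangle (S : set M) (a b c : M) :
  in_triangle a b c `<=` S ->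
  homotopic_in S (segment a b) (path_concat (segment a c) (segment c b)).
Proof.
move=> tS; apply: homotopic_straight.
- exact: segment_continuous.
- have sT x y : path_in setT (segment x y) by split=> //; exact: segment_continuous.
  have e : segment a c one = segment c b zero by rewrite segment0 segment1.
  exact: (path_in_concat (sT a c) (sT c b) e).1.
- by rewrite path_concat0 !segment0.
- by rewrite path_concat1 !segment1.
- move=> s t; apply: tS.
  have s0 := val_ge0 s; have s1 := val_le1 s.
  have t0 := val_ge0 t; have t1 := val_le1 t.
  rewrite /path_concat /segment; case: ifPn => t2.
    rewrite val_clamp; last by apply/andP; split; lra.
    exists ((1 - \val s) * (1 - \val t) + \val s * (1 - (2 * \val t + 0))).
    exists ((1 - \val s) * \val t), (\val s * (2 * \val t + 0)); split.
    + by rewrite addr_ge0 // mulr_ge0 //; lra.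
    + by rewrite mulr_ge0 //; lra.
    + by rewrite mulr_ge0 //; lra.
    + by lra.
    apply/funext => i; rewrite !scalerDr !scalerA !addrA scalerDl.
    by rewrite -!addrA; congr (_ + _); rewrite addrCA.
  rewrite val_clamp; last by apply/andP; split; lra.
  exists ((1 - \val s) * (1 - \val t)).
  exists ((1 - \val s) * \val t + \val s * (2 * \val t + -1)), (\val s * (1 - (2 * \val t + -1))); split.
  + by rewrite mulr_ge0 //; lra.
  + by rewrite addr_ge0 // mulr_ge0 //; lra.
  + by rewrite mulr_ge0 //; lra.
  + by lra.
  apply/funext => i; rewrite !scalerDr !scalerA !addrA scalerDl.
  by rewrite -!addrA; congr (_ + (_ + _)); rewrite addrC.
Qed.

End LinearComplement.

(** * Coning off paths in the complement of a linear arrangement *)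

Section GenericCone.
Context {R : realType} {n d : nat}.
Local Notation I := (unit_interval R).
Local Notation V := ('rV[R]_d).
Local Notation M := (prod_topology (fun _ : 'I_n => V)).

Local Notation constraint := ('I_n * 'I_n * 'cV[R]_d)%type.

(** A constraint [(i, j, f)] asks [w i - w j] to avoid the kernel of the linear
    form [f]; it excludes a hyperplane when [i != j] and [f != 0]. *)
Definition proper_constraints (L : seq constraint) : bool :=
  all (fun c => (c.1.1 != c.1.2) && (c.2 != 0)) L.

Definition generic (L : seq constraint) (w : M) : bool :=
  all (fun c => (w c.1.1 - w c.1.2) *m c.2 != 0) L.

Lemma continuous_functional (f : 'cV[R]_d) :
  continuous (fun v : V => (v *m f) 0 0 : R).
Proof.
have -> : (fun v : V => (v *m f) 0 0 : R) = (fun v => \sum_k v 0 k * f k 0).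
  by apply/funext => v; rewrite mxE.
elim: (index_enum _) => [|k s IHs].
  under eq_fun do rewrite big_nil; exact: cst_continuous.
under eq_fun do rewrite big_cons.
have addc (T : topologicalType) (g h : T -> R) (a : R) :
    continuous g -> continuous h -> continuous (fun z => g z * a + h z).
  move=> cg ch z; apply: cvgD; last exact: ch.
  by apply: cvgM; [exact: cg|exact: cvg_cst].
by apply: addc => //; exact: coord_continuous.
Qed.

Lemma continuous_sub_coord (i j : 'I_n) : continuous (fun w : M => w i - w j).
Proof.
have subc (T : topologicalType) (g h : T -> V) :
    continuous g -> continuous h -> continuous (fun z => g z - h z).
  by move=> cg ch z; apply: cvgB; [exact: cg|exact: ch].
by apply: subc; exact: continuous_coord.
Qed.

(** Finitely many hyperplanes do not cover an open set: if a point lies on the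
    hyperplane of [(i, j, f)], moving its [i]-th coordinate in the direction
    [f^T] leaves it at once. *)
Lemma exists_generic (L : seq constraint) (G : set M) :
  proper_constraints L -> open G -> G !=set0 -> exists2 w, G w & generic L w.
Proof.
elim: L G => [|[[i j] f] L IHL] G; first by move=> _ _ [w Gw]; exists w.
rewrite /proper_constraints /= => /andP[/andP[ij f0] Lp] oG [w0 Gw0].
pose phi (w : M) : R := ((w i - w j) *m f) 0 0.
have cphi : continuous phi.
  exact: (continuous_comp_fun (@continuous_sub_coord i j) (@continuous_functional f)).
have opn : open (G `&` phi @^-1` [set r | r != 0]).
  apply: openI => //; apply: open_comp; last exact: open_neq.
  by move=> w _; exact: cphi.
have mx11 (A : 'M[R]_1) : (A != 0) = (A 0 0 != 0).
  congr (~~ _); apply/eqP/eqP => [->|A0]; first by rewrite mxE.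
  by apply/matrixP => a b; rewrite !ord1 A0 mxE.
suff nz : (G `&` phi @^-1` [set r | r != 0]) !=set0.
  have [w [Gw phiw] gw] := IHL _ Lp opn nz; exists w => //.
  by rewrite /generic /= mx11 phiw.
have [phi0|phi0] := eqVneq (phi w0) 0; last by exists w0.
pose w (e : R) : M := fun k => if k == i then w0 k + e *: f^T else w0 k.
have cw : continuous w.
  apply: continuous_to_prod => k; rewrite /w; case: (k == i); last exact: cst_continuous.
  have -> : (fun e : R => w0 k + e *: f^T) = (fun e => 1 *: w0 k + e *: f^T).
    by apply/funext => e; rewrite scale1r.
  apply: continuous_lincomb; try exact: cst_continuous.
  by move=> e; exact: cvg_id.
have w00 : w 0 = w0.
  by apply/funext => k; rewrite /w scale0r addr0; case: ifP.
have : nbhs (0 : R) (w @^-1` G).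
  by apply: cw; rewrite w00; exact: open_nbhs_nbhs.
move=> /nbhs_ballP[e /= e0 eG].
exists (w (e / 2)); split.
  apply: eG; rewrite /ball /= sub0r normrN gtr0_norm; lra.
rewrite /= /phi /w eqxx [j == i]eq_sym (negbTE ij) addrAC mulmxDl mxE -/(phi w0) phi0 add0r.
rewrite -scalemxAl mxE mulf_neq0 //; first by rewrite gt_eqF //; lra.
rewrite mxE; under eq_bigr do rewrite mxE.
apply: contraNneq f0 => /eqP; rewrite psumr_eq0; last by move=> k _; rewrite -expr2 sqr_ge0.
move=> /allP fk; apply/eqP/matrixP => a b; rewrite ord1 mxE.
have := fk a (mem_index_enum _); rewrite mulf_eq0 orbb => /eqP.
by [].
Qed.

(** This is where codimension at least three enters: two vectors span at most a
    plane, which is contained in the kernel of a nonzero form. *)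
Lemma exists_annihilator (v v' : V) : (3 <= d)%N ->
  exists f : 'cV[R]_d, [/\ f != 0, v *m f = 0 & v' *m f = 0].
Proof.
move=> d3; pose A := col_mx v v'.
have : cokermx A != 0.
  rewrite -mxrank_eq0 mxrank_coker -lt0n subn_gt0.
  by apply: leq_ltn_trans d3; exact: rank_leq_row.
move=> /eqP cA0; have [j fj] : exists j, col j (cokermx A) != 0.
  apply/not_existsP => h; apply: cA0; apply/matrixP => a b.
  have /negP := h b; rewrite negbK => /eqP /matrixP /(_ a 0).
  by rewrite !mxE.
exists (col j (cokermx A)).
have : A *m col j (cokermx A) = 0 by rewrite colE mulmxA mulmx_coker mul0mx.
rewrite /A mul_col_mx => /eqP; rewrite col_mx_eq0 => /andP[/eqP vf /eqP v'f].
by split.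
Qed.

Definition convex_set (C : set V) : Prop := forall a b k,
  C a -> C b -> 0 <= k <= 1 -> C ((1 - k) *: a + k *: b).

Lemma convex_ball (v : V) (e : R) : convex_set (ball v e).
Proof.
move=> a b t; rewrite -!ball_normE /= => va vb /andP[t0 t1].
have -> : v - ((1 - t) *: a + t *: b) = (1 - t) *: (v - a) + t *: (v - b).
  by rewrite !scalerBr addrACA -scalerDl subrK scale1r opprD.
rewrite (le_lt_trans (ler_normD _ _)) // !normrZ ger0_norm; last by lra.
rewrite (ger0_norm t0).
have [->|tn0] := eqVneq t 0; first by rewrite subr0 mul1r mul0r addr0.
have tp : 0 < t by rewrite lt_neqAle eq_sym tn0.
have -> : e = (1 - t) * e + t * e by rewrite -mulrDl subrK mul1r.
apply: ler_ltD; first by apply: ler_wpM2l; [lra|exact: ltW].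
by rewrite ltr_pM2l.
Qed.

Hypothesis d3 : (3 <= d)%N.
Variables (E : rel 'I_n) (B : 'I_n -> set V).
Hypothesis E_irr : forall i j, E i j -> i != j.
Hypothesis B_open : forall i, open (B i).

Hypothesis B_convex : forall i, convex_set (B i).

(** The complement, in a convex box, of the subspaces [y i = y j] for the pairs
    related by [E]. *)
Definition region : set M :=
  [set y | (forall i, B i (y i)) /\ forall i j, E i j -> y i <> y j].

Definition segment_constraints (v v' : M) : seq constraint :=
  [seq (ij, projT1 (cid (exists_annihilator (v ij.1 - v ij.2) (v' ij.1 - v' ij.2) d3)))
  | ij <- enum {: 'I_n * 'I_n} & E ij.1 ij.2].

Lemma segment_constraints_proper v v' : proper_constraints (segment_constraints v v').
Proof.
apply/allP => c /mapP[ij]; rewrite mem_filter => /andP[Eij _] ->.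
by rewrite /= E_irr //=; case: cid => f [].
Qed.

(** The cone from [w] over a segment in the region stays in the region: a form
    that vanishes on [v i - v j] and [v' i - v' j] but not on [w i - w j] shows
    that a point of the triangle on the subspace [y i = y j] has no component
    along the apex, hence lies on the segment. *)
Lemma triangle_in_region (v v' w : M) :
  (forall t, region (segment v v' t)) -> (forall i, B i (w i)) ->
  generic (segment_constraints v v') w -> in_triangle v v' w `<=` region.
Proof.
move=> Svv Bw gw y [k [l [m [k0 l0 m0 klm yE]]]].
have [m_eq0|m_neq0] := eqVneq m 0.
  suff -> : y = segment v v' (clamp l) by [].
  rewrite yE; apply/funext => i; rewrite m_eq0 scale0r addr0 /segment.
  rewrite val_clamp; last by apply/andP; split; lra.
  by congr (_ *: _ + _); lra.
split=> [i|i j Eij yij].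
- have [kl0|kl0] := eqVneq (k + l) 0.
    have [k00 l00 m1] : [/\ k = 0, l = 0 & m = 1] by split; lra.
    by rewrite yE k00 l00 m1 !scale0r !add0r scale1r.
  have klp : 0 < k + l by rewrite lt_neqAle eq_sym kl0 addr_ge0.
  have t01 : 0 <= l / (k + l) <= 1.
    by rewrite divr_ge0 ?(ltW klp) //= ler_pdivrMr // mul1r lerDr.
  have -> : y i = (1 - m) *: segment v v' (clamp (l / (k + l))) i + m *: w i.
    rewrite yE /segment val_clamp // scalerDr !scalerA.
    have -> : 1 - m = k + l by lra.
    by congr (_ *: _ + _ *: _ + _); field.
  apply: B_convex => //; first exact: (Svv _).1.
  by apply/andP; split; lra.
have [ij_in] : (i, j) \in [seq ij <- enum {: 'I_n * 'I_n} | E ij.1 ij.2].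
  by rewrite mem_filter Eij mem_enum.
have /allP/(_ _ (map_f _ ij_in)) := gw; rewrite /=.
case: cid => f /= [_ vf v'f] /eqP; apply.
have : (y i - y j) *m f = 0 by rewrite yij subrr mul0mx.
have -> : y i - y j = k *: (v i - v j) + l *: (v' i - v' j) + m *: (w i - w j).
  by rewrite yE !scalerBr opprD opprD addrACA (addrACA (k *: _)).
rewrite !mulmxDl -!scalemxAl vf v'f !scaler0 !add0r => /eqP.
by rewrite scaler_eq0 (negbTE m_neq0) -mulmxDl => /= /eqP.
Qed.

Lemma region_open : open region.
Proof.
rewrite openE => y [By Ey].
have h1 : nbhs y [set z : M | forall i, B i (z i)].
  by apply: nbhs_box => i; exact: open_nbhs_nbhs.
have h2 : nbhs y [set z : M | forall ij : 'I_n * 'I_n, E ij.1 ij.2 -> z ij.1 <> z ij.2].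
  apply: filter_forall_fin => -[i j] /=.
  have [Eij|nE] := boolP (E i j); last by apply: filterS filterT => z _.
  have c := @continuous_sub_coord i j.
  have o : open [set v : V | v <> 0].
    have -> : [set v : V | v <> 0] = ~` [set 0] by [].
    apply: closed_openC.
    exact: (accessible_closed_set1 (hausdorff_accessible (@norm_hausdorff R V))).
  have : nbhs (y i - y j) [set v : V | v <> 0].
    apply: open_nbhs_nbhs; split=> //= /eqP; rewrite subr_eq0 => /eqP; exact: Ey.
  move=> /(c y); apply: (@filterS _ _ (@nbhs_filter M y)) => z /= zij _ zij'.
  by apply: zij; rewrite zij' subrr.
apply: filterS (filterI h1 h2) => z [Bz Ez]; split=> // i j; exact: (Ez (i, j)).
Qed.

Definition small_convex (C : set M) : Prop :=
  C `<=` region /\ forall a b t, C a -> C b -> C (segment a b t).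

Let small_convex_nbhs y : region y -> exists2 C, small_convex C & nbhs y C.
Proof.
move=> Sy; have : nbhs y region by apply: open_nbhs_nbhs; split=> //; exact: region_open.
move=> /nbhs_prodP[O nO OS].
have bO i : exists e : R, 0 < e /\ ball (y i) e `<=` O i.
  by have /nbhs_ballP[e e0 eO] := nO i; exists e.
pose e i := projT1 (cid (bO i)).
have e0 i : 0 < e i by rewrite /e; case: cid => ? [].
have eO i : ball (y i) (e i) `<=` O i by rewrite /e; case: cid => ? [].
exists [set z : M | forall i, ball (y i) (e i) (z i)]; last first.
  by apply: (@nbhs_box n V y (fun i => ball (y i) (e i))) => i; exact: (nbhsx_ballx (y i) (e i) (e0 i)).
split; first by move=> z Cz; apply: OS => i; exact/eO.
move=> a b t Ca Cb i; have := Ca i; have := Cb i; rewrite -!ball_normE /= /segment => bi ai.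
have := @convex_ball (y i) (e i) (a i) (b i) (\val t).
rewrite -!ball_normE /=; apply => //.
by rewrite val_ge0 val_le1.
Qed.

(** Coning off: a path is a chain of short, hence straight, pieces, and for an
    apex in general position the cone over each piece misses the codimension [d]
    subspaces [y i = y j]; so the path is homotopic to the detour through the
    apex.  General position means avoiding finitely many proper subspaces, so one
    apex serves any two paths at once. *)
Lemma homotopic_cone (u : I -> M) : path_in region u ->
  exists2 L, proper_constraints L & forall w, (forall i, B i (w i)) -> generic L w ->
    homotopic_in region u (path_concat (segment (u zero) w) (segment w (u one))).
Proof.
move=> [cu Su].
apply: (@path_bisection R M small_convex (fun u => exists2 L, proper_constraints L &
  forall w, (forall i, B i (w i)) -> generic L w ->
    homotopic_in region u (path_concat (segment (u zero) w) (segment w (u one))))) => //.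
- move=> p C cp [CS Cc] Cp.
  exists (segment_constraints (p zero) (p one)); first exact: segment_constraints_proper.
  move=> w Bw gw.
  apply: (homotopic_in_trans (q := segment (p zero) (p one))).
    apply: homotopic_straight => //; first exact: segment_continuous.
    + by rewrite segment0.
    + by rewrite segment1.
    + by move=> s t; apply/CS/Cc => //; apply: Cc.
  apply: homotopic_triangle; apply: triangle_in_region => // t.
  by apply/CS/Cc.
- move=> p cp [L1 L1p hL1] [L2 L2p hL2].
  exists (L1 ++ L2); first by rewrite /proper_constraints all_cat; apply/andP; split.
  move=> w Bw; rewrite /generic all_cat => /andP[gL1 gL2].
  have h1 := hL1 w Bw gL1; have h2 := hL2 w Bw gL2.
  rewrite -[p in homotopic_in _ p _]concat_halves.
  rewrite first_half0 first_half1 in h1; rewrite second_half1 in h2.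
  set m := second_half p zero in h1 h2.
  have halves (a b : M) : path_in region (path_concat (segment a w) (segment w b)) ->
      path_in region (segment a w) /\ path_in region (segment w b).
    move=> Sab; have e : segment a w one = segment w b zero by rewrite segment0 segment1.
    split; first by rewrite -(first_half_concat e); exact: path_in_first.
    by rewrite -(second_half_concat e); exact: path_in_second.
  have [S1 S2] := halves _ _ (homotopic_in_path h1).2.
  have [S3 S4] := halves _ _ (homotopic_in_path h2).2.
  apply: (homotopic_in_trans (q := path_concat
    (path_concat (segment (p zero) w) (segment w m)) (path_concat (segment m w) (segment w (p one))))).
    by apply: homotopic_in_concat => //; exact: first_half1.
  by rewrite -(path_rev_segment w m); apply: homotopic_in_cancel => //; rewrite segment0 segment1.
- move=> t; have [C sC nC] := small_convex_nbhs (Su t).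
  by exists C.
Qed.

Hypothesis B_nonempty : forall i, B i !=set0.

Let exists_apex (L : seq constraint) : proper_constraints L ->
  exists2 w : M, forall i, B i (w i) & generic L w.
Proof.
move=> Lp; apply: (@exists_generic L [set w : M | forall i, B i (w i)]) => //.
  rewrite openE => y By; apply: nbhs_box => i; exact: open_nbhs_nbhs.
by exists (fun i => projT1 (cid (B_nonempty i))) => i; case: cid.
Qed.

Lemma region_nonempty : region !=set0.
Proof.
have [w Bw gw] := exists_apex (segment_constraints_proper (fun=> 0) (fun=> 0)).
exists w; split=> // i j Eij wij.
have ij_in : (i, j) \in [seq ij <- enum {: 'I_n * 'I_n} | E ij.1 ij.2].
  by rewrite mem_filter Eij mem_enum.
have /allP/(_ _ (map_f _ ij_in)) := gw; rewrite /= wij.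
by rewrite subrr mul0mx eqxx.
Qed.

Lemma region_path_connected a b : region a -> region b ->
  exists p : I -> M, [/\ path_in region p, p zero = a & p one = b].
Proof.
move=> Sa Sb.
have [La Lap ha] := homotopic_cone (path_in_cst Sa).
have [Lb Lbp hb] := homotopic_cone (path_in_cst Sb).
have [|w Bw] := @exists_apex (La ++ Lb).
  by rewrite /proper_constraints all_cat; apply/andP; split.
rewrite /generic all_cat => /andP[/(ha _ Bw) ga /(hb _ Bw) gb].
have Saw : path_in region (segment a w).
  have e : segment a w one = segment w a zero by rewrite segment0 segment1.
  by rewrite -(first_half_concat e); apply/path_in_first/(homotopic_in_path ga).2.
have Swb : path_in region (segment w b).
  have e : segment b w one = segment w b zero by rewrite segment0 segment1.
  by rewrite -(second_half_concat e); apply/path_in_second/(homotopic_in_path gb).2.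
exists (path_concat (segment a w) (segment w b)); split.
- by apply: path_in_concat => //; rewrite segment0 segment1.
- by rewrite path_concat0 segment0.
- by rewrite path_concat1 segment1.
Qed.

Lemma region_simply_connected (u v : I -> M) : path_in region u -> path_in region v ->
  u zero = v zero -> u one = v one -> homotopic_in region u v.
Proof.
move=> /homotopic_cone[Lu Lup hu] /homotopic_cone[Lv Lvp hv] uv0 uv1.
have [|w Bw] := @exists_apex (Lu ++ Lv).
  by rewrite /proper_constraints all_cat; apply/andP; split.
rewrite /generic all_cat => /andP[/(hu _ Bw) gu /(hv _ Bw) gv].
apply: homotopic_in_trans gu _; rewrite uv0 uv1.
exact: homotopic_in_sym.
Qed.

End GenericCone.

(** * General position in powers of a manifold *)

Section Cells.
Context {R : realType} {d : nat} {X : topologicalType}.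
Local Notation I := (unit_interval R).
Local Notation V := ('rV[R]_d).

Record cell := Cell {
  cell_set : set X;
  cell_ball : set V;
  cell_map : X -> V;
  cell_inv : V -> X;
  cell_open : open cell_set;
  cell_ball_open : open cell_ball;
  cell_ball_convex : convex_set cell_ball;
  cell_ball_nonempty : cell_ball !=set0;
  cell_mapP : forall x, cell_set x -> cell_ball (cell_map x);
  cell_invP : forall v, cell_ball v -> cell_set (cell_inv v);
  cell_mapK : forall x, cell_set x -> cell_inv (cell_map x) = x;
  cell_invK : forall v, cell_ball v -> cell_map (cell_inv v) = v;
  cell_map_continuous : forall x, cell_set x -> {for x, continuous cell_map};
  cell_inv_continuous : forall v, cell_ball v -> {for v, continuous cell_inv}
}.

(** The preimage of a small ball under a chart. *)
Lemma exists_cell (p : X) (N : set X) : smooth_manifold R d X -> nbhs p N ->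
  exists O : cell, cell_set O p /\ cell_set O `<=` N.
Proof.
move=> [_ _ [A [Acover _]]] Np.
have [a _ ap] : (\bigcup_(a in A) chart_dom a) p by rewrite Acover.
have oD := @chart_dom_open _ _ _ a; have oC := @chart_codom_open _ _ _ a.
have cf x : chart_dom a x -> {for x, continuous (chart_map a)}.
  have := @chart_map_continuous _ _ _ a; rewrite continuous_open_subspace //.
  by move=> h ax; apply: h; rewrite inE.
have cg v : (chart_map a @` chart_dom a) v -> {for v, continuous (chart_inv a)}.
  have := @chart_inv_continuous _ _ _ a; rewrite continuous_open_subspace //.
  by move=> h ax; apply: h; rewrite inE.
have fK x : chart_dom a x -> chart_inv a (chart_map a x) = x.
  by move=> ax; apply: chart_mapK; rewrite inE.
have fpC : (chart_map a @` chart_dom a) (chart_map a p) by exists p.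
have n1 : nbhs (chart_map a p) (chart_inv a @^-1` N).
  by apply: (cg _ fpC); rewrite fK.
have n2 : nbhs (chart_map a p) (chart_map a @` chart_dom a).
  by apply: open_nbhs_nbhs.
have n12 : nbhs (chart_map a p) (chart_inv a @^-1` N `&` chart_map a @` chart_dom a).
  exact: filterI.
have /nbhs_ballP[e /= e0 eN] := n12.
pose B : set V := ball (chart_map a p) e.
have bC v : B v -> exists2 x, chart_dom a x & chart_map a x = v.
  by move=> /eN[_ [x ax xv]]; exists x.
pose O := chart_dom a `&` chart_map a @^-1` B.
have oB : open B by exact: ball_open.
have oO : open O.
  rewrite openE => x [ax Bx]; apply: filterI; first exact: open_nbhs_nbhs.
  by apply: (cf _ ax); exact: open_nbhs_nbhs.
have Bp : B (chart_map a p) by exact: ballxx.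
have invP v : B v -> O (chart_inv a v).
  by move=> Bv; have [x ax xv] := bC v Bv; rewrite -xv fK //; split=> //=; rewrite xv.
have invK v : B v -> chart_map a (chart_inv a v) = v.
  by move=> Bv; have [x ax xv] := bC v Bv; rewrite -xv fK.
have mapP x : O x -> B (chart_map a x) by case.
have mapK x : O x -> chart_inv a (chart_map a x) = x by case=> ax _; exact: fK.
have cf' x : O x -> {for x, continuous (chart_map a)} by case=> ax _; exact: cf.
have cg' v : B v -> {for v, continuous (chart_inv a)}.
  by move=> Bv; apply: cg; exact: (eN _ Bv).2.
have Bne : B !=set0 by exists (chart_map a p).
exists (Cell oO oB (@convex_ball R d (chart_map a p) e) Bne mapP invP mapK invK cf' cg').
split=> //= x [ax Bx].
by have [/= + _] := eN _ Bx; rewrite fK.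
Qed.

Section CellBox.
Context {n : nat}.
Local Notation M := (prod_topology (fun _ : 'I_n => X)).
Variables (O : 'I_n -> cell) (E : rel 'I_n).
Hypothesis E_irr : forall i j, E i j -> i != j.
Hypothesis E_same : forall i j, E i j -> O i = O j.
Hypothesis d3 : (3 <= d)%N.

(** Related indices share their cell, so the coordinates turn the condition
    [y i <> y j] into the same condition in the Euclidean box. *)
Definition cell_region : set M :=
  [set y | (forall i, cell_set (O i) (y i)) /\ forall i j, E i j -> y i <> y j].

Let S := @region R n d E (fun i => cell_ball (O i)).
Let f (y : M) : prod_topology (fun _ : 'I_n => V) := fun i => cell_map (O i) (y i).
Let g (v : prod_topology (fun _ : 'I_n => V)) : M := fun i => cell_inv (O i) (v i).

Let fP y : cell_region y -> S (f y).
Proof.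
move=> [Oy Ey]; split=> [i|i j Eij]; first exact: cell_mapP.
have Oij : cell_set (O i) (y j) by rewrite (E_same Eij).
rewrite /f -(E_same Eij) => /(congr1 (cell_inv (O i))).
by rewrite !cell_mapK //; exact: Ey.
Qed.

Let gP v : S v -> cell_region (g v).
Proof.
move=> [Bv Ev]; split=> [i|i j Eij]; first exact: cell_invP.
have Bij : cell_ball (O i) (v j) by rewrite (E_same Eij); exact: Bv.
rewrite /g -(E_same Eij) => /(congr1 (cell_map (O i))).
by rewrite !cell_invK //; exact: Ev.
Qed.

Let fK y : cell_region y -> g (f y) = y.
Proof. by move=> [Oy _]; apply/funext => i; exact: cell_mapK. Qed.

Let cf y : cell_region y -> {for y, continuous f}.
Proof.
move=> [Oy _]; apply: continuous_at_prod => i.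
apply: (@continuous_comp _ _ _ (fun y : M => y i) (cell_map (O i))).
  exact: continuous_coord.
exact: cell_map_continuous.
Qed.

Let cg v : S v -> {for v, continuous g}.
Proof.
move=> [Bv _]; apply: continuous_at_prod => i.
apply: (@continuous_comp _ _ _ (fun y : prod_topology (fun _ : 'I_n => V) => y i) (cell_inv (O i))).
  exact: continuous_coord.
exact: cell_inv_continuous.
Qed.

Lemma cell_region_nonempty : cell_region !=set0.
Proof.
have [|||v Sv] := @region_nonempty R n d d3 E (fun i => cell_ball (O i)) => //.
- by move=> i; exact: cell_ball_open.
- by move=> i; exact: cell_ball_nonempty.
by exists (g v); exact: gP.
Qed.

Lemma cell_region_path_connected a b : cell_region a -> cell_region b ->
  exists p : I -> M, [/\ path_in cell_region p, p zero = a & p one = b].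
Proof.
move=> Ra Rb; have [p [Sp p0 p1]] := region_path_connected d3 E_irr
  (fun i => @cell_ball_open (O i)) (fun i => @cell_ball_convex (O i))
  (fun i => @cell_ball_nonempty (O i)) (fP Ra) (fP Rb).
exists (g \o p); split; rewrite /= ?p0 ?p1 ?fK //.
exact: path_in_comp Sp.
Qed.

Lemma cell_region_simply_connected (p q : I -> M) :
  path_in cell_region p -> path_in cell_region q ->
  p zero = q zero -> p one = q one -> homotopic_in cell_region p q.
Proof.
move=> Rp Rq pq0 pq1.
have Sp : path_in S (f \o p) by exact: path_in_comp Rp.
have Sq : path_in S (f \o q) by exact: path_in_comp Rq.
have h := region_simply_connected d3 E_irr
  (fun i => @cell_ball_open (O i)) (fun i => @cell_ball_convex (O i))
  (fun i => @cell_ball_nonempty (O i)) Sp Sq.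
have := homotopic_in_comp cg gP (h (congr1 f pq0) (congr1 f pq1)).
have -> : g \o (f \o p) = p by apply/funext => t /=; rewrite fK //; exact: Rp.2.
by have -> : g \o (f \o q) = q by apply/funext => t /=; rewrite fK //; exact: Rq.2.
Qed.

End CellBox.

Section GeneralPosition.
Context {n : nat}.
Local Notation M := (prod_topology (fun _ : 'I_n => X)).
Hypothesis X_manifold : smooth_manifold R d X.
Hypothesis d3 : (3 <= d)%N.

Definition configurations : set M := [set y : M | injective y].

(** Cells are chosen as a function of the point [p i] rather than of [i], so that
    repeated points get the same cell, and inside separating neighbourhoods, so
    that distinct points get disjoint ones. *)
Lemma exists_cell_box (p : M) (N : set M) : nbhs p N ->
  exists O : 'I_n -> cell, [/\ forall i, cell_set (O i) (p i),
    [set y : M | forall i, cell_set (O i) (y i)] `<=` N,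
    forall i j, p i = p j -> O i = O j
  & forall i j x, p i <> p j -> cell_set (O i) x -> cell_set (O j) x -> False].
Proof.
move=> /nbhs_prodP[W nW WN].
have [+ _ _] := X_manifold; rewrite open_hausdorff => hX.
have sep (x y : X) : exists AB : set X * set X, x != y ->
    [/\ nbhs x AB.1, nbhs y AB.2 & forall z, AB.1 z -> AB.2 z -> False].
  have [->|xy] := eqVneq x y; first by exists (setT, setT).
  have [AB [/set_mem xA /set_mem yB] [oA oB /eqP AB0]] := hX x y xy.
  exists AB => _; split; [exact: open_nbhs_nbhs|exact: open_nbhs_nbhs|].
  by move=> z Az Bz; have : (AB.1 `&` AB.2) z by []; rewrite AB0.
pose D x y := projT1 (cid (sep x y)).
have DP x y : x != y -> [/\ nbhs x (D x y).1, nbhs y (D x y).2 &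
    forall z, (D x y).1 z -> (D x y).2 z -> False].
  by rewrite /D; case: cid.
pose Nb (x : X) : set X := [set q | forall k,
  [/\ p k = x -> W k q, p k != x -> (D x (p k)).1 q & p k != x -> (D (p k) x).2 q]].
have nNb x : nbhs x (Nb x).
  apply: filter_forall_fin => k.
  have [<-|pkx] := eqVneq (p k) x; first by apply: filterS (nW k) => q Wq; split.
  have xpk : x != p k by rewrite eq_sym.
  have [n1 _ _] := DP _ _ xpk; have [_ n2 _] := DP _ _ pkx.
  apply: filterS (filterI n1 n2) => q [q1 q2]; split=> // e.
  by rewrite e eqxx in pkx.
pose O x := projT1 (cid (exists_cell X_manifold (nNb x))).
have Ox x : cell_set (O x) x by rewrite /O; case: cid => ? [].
have ON x : cell_set (O x) `<=` Nb x by rewrite /O; case: cid => ? [].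
exists (fun i => O (p i)); split=> [i|y Oy|i j -> //|i j x pij Oi Oj] //.
- by apply: WN => i; have [+ _ _] := ON _ _ (Oy i) i; apply.
have pij' : p i != p j by apply/eqP.
have [_ _ disj] := DP _ _ pij'.
apply: (disj x).
  by have [_ + _] := ON _ _ Oi j; apply; rewrite eq_sym.
by have [_ _ +] := ON _ _ Oj i; apply.
Qed.

Lemma box_homotopic (O : 'I_n -> cell) (p q : I -> M) :
  (forall t i, cell_set (O i) (p t i)) -> (forall t i, cell_set (O i) (q t i)) ->
  continuous p -> continuous q ->
  p zero = q zero -> p one = q one -> homotopic_in setT p q.
Proof.
move=> Op Oq cp cq pq0 pq1.
apply: (@homotopic_inS _ _ (cell_region O (fun _ _ => false))) => //.
by apply: cell_region_simply_connected => //; split.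
Qed.

Lemma box_path_connected (O : 'I_n -> cell) (a b : M) :
  (forall i, cell_set (O i) (a i)) -> (forall i, cell_set (O i) (b i)) ->
  exists p : I -> M, [/\ continuous p, forall t i, cell_set (O i) (p t i),
    p zero = a & p one = b].
Proof.
move=> Oa Ob.
pose E (i j : 'I_n) := false.
have E_irr i j : E i j -> i != j by [].
have E_same i j : E i j -> O i = O j by [].
have Ra : cell_region O E a by [].
have Rb : cell_region O E b by [].
have [p [[cp Rp] p0 p1]] := cell_region_path_connected E_irr E_same d3 Ra Rb.
by exists p; split=> // t i; exact: (Rp t).1.
Qed.

Lemma box_open (O : 'I_n -> cell) : open [set y : M | forall i, cell_set (O i) (y i)].
Proof.
rewrite openE => y Oy; apply: (@nbhs_box n X y (fun i => cell_set (O i))) => i.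
by apply: open_nbhs_nbhs; split=> //; exact: cell_open.
Qed.

Lemma homotopic_in_congruence (T : topologicalType) (S : set T) :
  path_congruence S (@homotopic_in R T S).
Proof.
split.
- by move=> p q _ _; exact: homotopic_in_sym.
- by move=> p q r _ _ _; exact: homotopic_in_trans.
- by move=> p p' q q' _ _ _ _ pq _; exact: homotopic_in_concat.
- by move=> p phi; exact: homotopic_in_reparam.
Qed.

Lemma product_locally_good : locally_good setT (@homotopic_in R M setT).
Proof.
move=> x N /exists_cell_box[O [Ox ON _ _]].
exists [set y : M | forall i, cell_set (O i) (y i)]; split=> //; split.
- exact: box_open.
- by exists x; split.
- move=> a b [Oa _] [Ob _]; have [p [cp Op p0 p1]] := box_path_connected Oa Ob.
  by exists p; split=> //; split=> // t; split=> // i; exact: Op.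
- move=> p q [cp Op] [cq Oq] pq0 pq1; apply: (@box_homotopic O) => // t i.
    exact: (Op t).1.
  exact: (Oq t).1.
Qed.

(** Near [x], configurations are cut out by the pairs of indices with equal
    coordinates in [x], since the other coordinates lie in disjoint cells. *)
Lemma configurations_locally_good :
  locally_good configurations (@homotopic_in R M configurations).
Proof.
move=> x N /exists_cell_box[O [Ox ON Osame Odisj]].
pose E i j := (i != j) && (x i == x j).
have E_irr i j : E i j -> i != j by case/andP.
have E_same i j : E i j -> O i = O j by case/andP=> _ /eqP; exact: Osame.
pose B : set M := [set y : M | forall i, cell_set (O i) (y i)].
have BE : B `&` configurations = cell_region O E.
  apply/seteqP; split=> [y [Oy yi]|y [Oy Ey]].
    by split=> // i j /E_irr /eqP ij /yi.
  split=> // i j yij; apply: contrapT => ij.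
  have [xij|xij] := eqVneq (x i) (x j).
    by apply: (Ey i j) => //; rewrite /E xij eqxx andbT; apply/eqP.
  by apply: (Odisj i j (y i)) => //; [exact/eqP|rewrite yij].
exists B; split=> //; split.
- exact: box_open.
- by rewrite BE; exact: cell_region_nonempty.
- by rewrite BE => a b; exact: cell_region_path_connected.
- move=> p q; rewrite BE => Rp Rq pq0 pq1.
  apply: (@homotopic_inS _ _ (cell_region O E)).
    by rewrite -BE => y [].
  exact: cell_region_simply_connected.
Qed.

(** General position for paths: an approximation off the diagonals within a thin
    tube is homotopic to the given path, because tubes of the product determine
    homotopy classes. *)
Theorem path_off_diagonal (g : I -> M) : continuous g ->
  configurations (g zero) -> configurations (g one) ->
  exists2 u, path_in configurations u & homotopic_in setT g u.
Proof.
move=> cg g0 g1.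
have [Om tOm EOm] := congruent_in_tube (homotopic_in_congruence _) product_locally_good cg.
have [u [Cu u0 u1 Omu]] := path_in_tube configurations_locally_good cg tOm g0 g1.
exists u => //; apply: EOm => //; first by split; [exact: Cu.1|].
by move=> t; exact: nbhs_singleton (tOm t).
Qed.

(** General position for homotopies: invariance under homotopies of the product,
    applied to the relation of being homotopic off the diagonals. *)
Theorem homotopy_off_diagonal (p q : I -> M) :
  path_in configurations p -> path_in configurations q ->
  homotopic_in setT p q -> homotopic_in configurations p q.
Proof.
apply: homotopic_congruent; first exact: homotopic_in_congruence.
exact: configurations_locally_good.
Qed.

End GeneralPosition.
End Cells.

(** * The covering of the unordered by the ordered configurations *)

Section Covering.
Context {R : realType} {d n : nat} {X : topologicalType}.
Local Notation I := (unit_interval R).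
Local Notation M := (prod_topology (fun _ : 'I_n => X)).
Local Notation F := (Fconf n X).
Local Notation D := (Dconf n X).
Local Notation C := (@configurations X n).

Lemma Dconf_eq (A B : D) : \val A = \val B -> A = B.
Proof. exact: val_inj. Qed.

Lemma Fconf_val_continuous : continuous (\val : F -> M).
Proof. exact: (@initial_continuous F M set_val). Qed.

Lemma config_set_continuous : continuous (config_set : F -> D).
Proof. by apply/continuousP => U; rewrite Dconf_openE. Qed.

Lemma exists_config_map (Z : topologicalType) (h : Z -> M) :
  continuous h -> (forall z, C (h z)) ->
  exists2 k : Z -> D, continuous k & forall z, \val (k z) = range (h z).
Proof.
move=> ch Ch.
pose hF z : F := exist _ (h z) (mem_set (Ch z)).
have chF : continuous hF by apply: (@continuous_comp_initial F Z M set_val).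
exists (fun z => config_set (hF z)) => //.
exact: (continuous_comp_fun chF config_set_continuous).
Qed.

Lemma exists_ordering (A : D) : exists2 y : M, C y & range y = \val A.
Proof.
exists (\val (ordering A)); first exact: Fconf_inj.
by have /(congr1 \val) := orderingK A.
Qed.

Lemma same_range_perm (y z : M) : C y -> C z -> range y = range z ->
  exists s : 'S_n, forall i, z i = y (s i).
Proof.
move=> Cy Cz yz; pose yF : F := exist _ y (mem_set Cy); pose zF : F := exist _ z (mem_set Cz).
have /config_set_eqP[s sE] : config_set yF = config_set zF by exact: Dconf_eq.
by exists s => i; have := congr1 (fun w : 'I_n -> X => w i) sE.
Qed.

Lemma Dconf_open_local (U : set D) :
  (forall z : F, U (config_set z) -> exists2 W : set M, nbhs (\val z) W &
     forall z' : F, W (\val z') -> U (config_set z')) -> open U.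
Proof.
move=> h; rewrite Dconf_openE openE => z Uz; have [W nW WU] := h z Uz.
have nz := @Fconf_val_continuous z _ nW.
by apply: (@filterS _ _ (@nbhs_filter F z) _ _ _ nz) => z'; exact: WU.
Qed.

(** Makes the points of a lifted path depend continuously on the configuration. *)
Lemma open_meets (G : set X) : open G -> open [set A : D | \val A `&` G !=set0].
Proof.
move=> oG; apply: Dconf_open_local => z /= [_ [[i _ <-] Gi]].
exists [set w : M | G (w i)].
  by apply: (@continuous_coord n X i (\val z)); exact: open_nbhs_nbhs.
by move=> z' Gz'; exists (\val z' i); split=> //; exists i.
Qed.

Section Boxes.
Variable O : 'I_n -> @cell R d X.

Definition disjoint_cells := forall i j x,
  cell_set (O i) x -> cell_set (O j) x -> i = j.

Definition box_ordering (A : D) (y : M) : Prop :=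
  (forall i, cell_set (O i) (y i)) /\ range y = \val A.

(** For disjoint cells these are the evenly covered open sets: a configuration
    with one point in each cell is ordered by the cells. *)
Definition box_image : set D := [set A | exists y, box_ordering A y].

Hypothesis O_disj : disjoint_cells.

Lemma box_configuration (y : M) : (forall i, cell_set (O i) (y i)) -> C y.
Proof. by move=> Oy i j yij; apply: (@O_disj i j (y i)) => //; rewrite yij. Qed.

Lemma box_ordering_unique A y x i : box_ordering A y ->
  \val A x -> cell_set (O i) x -> x = y i.
Proof. by move=> [Oy <-] [j _ <-] Oi; congr y; exact: (@O_disj _ _ (y j)). Qed.

Lemma box_image_open : open box_image.
Proof.
apply: Dconf_open_local => z [y [Oy yz]].
have [s sE] : exists s : 'S_n, forall i, y i = \val z (s i).
  by apply: same_range_perm => //; [exact: Fconf_inj|exact: box_configuration].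
exists [set w : M | forall i, cell_set (O i) (w (s i))].
  apply: filter_forall_fin => i; apply: (@continuous_coord n X (s i) (\val z)).
  by apply: open_nbhs_nbhs; split; [exact: cell_open|rewrite /= -sE].
move=> z' Wz'; exists (fun i => \val z' (s i)); split=> //=.
apply/seteqP; split=> _ [i _ <-]; first by exists (s i).
by exists (s^-1%g i) => //; rewrite permKV.
Qed.

End Boxes.

(** Lifts are maps to the product rather than to the space of ordered
    configurations, so that their strands and homotopies need no coercions. *)
Definition lifts (l : I -> M) (u : I -> D) : Prop :=
  path_in C l /\ forall t, range (l t) = \val (u t).

Lemma lifts_affine l u a b : lifts l u ->
  lifts (fun t => l (clamp (a * \val t + b))) (fun t => u (clamp (a * \val t + b))).
Proof. by move=> [Cl lu]; split=> //; exact: path_in_affine. Qed.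

Lemma lifts_first l u : lifts l u -> lifts (first_half l) (first_half u).
Proof. exact: lifts_affine. Qed.
Lemma lifts_second l u : lifts l u -> lifts (second_half l) (second_half u).
Proof. exact: lifts_affine. Qed.

Lemma lifts_concat l l' u u' : lifts l u -> lifts l' u' -> l one = l' zero ->
  lifts (path_concat l l') (path_concat u u').
Proof.
move=> [Cl lu] [Cl' lu'] ll'; split; first exact: path_in_concat.
by move=> t; rewrite /path_concat; case: ifP.
Qed.

Definition small_image (V : set D) : Prop :=
  exists2 O, disjoint_cells O & V = box_image O.

Hypothesis X_manifold : smooth_manifold R d X.
Hypothesis d3 : (3 <= d)%N.

Lemma small_image_nbhs (A : D) (N : set D) : nbhs A N ->
  exists O, [/\ disjoint_cells O, box_image O A & box_image O `<=` N].
Proof.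
have [z <-] : exists z : F, config_set z = A by exists (ordering A); exact: orderingK.
move=> /(config_set_continuous) [_ [[W oW <-] /= Wz WN]].
have nW : nbhs (\val z : M) W by exact: open_nbhs_nbhs.
have [O [Oz OW _ Odisj]] := exists_cell_box X_manifold nW.
have O_disj : disjoint_cells O.
  move=> i j x Oi Oj; apply: contrapT => ij.
  by apply: (Odisj i j x) => // /Fconf_inj.
exists O; split=> //; first by exists (\val z); split.
move=> B [y [Oy yB]].
pose yF : F := exist _ y (mem_set (box_configuration O_disj Oy)).
have -> : B = config_set yF by exact: Dconf_eq.
by apply: WN; exact: OW.
Qed.

Let small_cover (u : I -> D) t : exists2 V, small_image V & nbhs (u t) V.
Proof.
have [O [O_disj Ou _]] := small_image_nbhs (@filterT _ _ (@nbhs_filter D (u t))).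
exists (box_image O); first by exists O.
by apply: open_nbhs_nbhs; split=> //; exact: box_image_open.
Qed.

Theorem path_lifting (u : I -> D) (y : M) : continuous u -> C y ->
  range y = \val (u zero) -> exists2 l, lifts l u & l zero = y.
Proof.
move=> cu.
suff : forall y, C y -> range y = \val (u zero) -> exists2 l, lifts l u & l zero = y by apply.
apply: (@path_bisection R D small_image (fun u => forall y, C y ->
  range y = \val (u zero) -> exists2 l, lifts l u & l zero = y)) => // {u cu y}.
- move=> u _ cu [O O_disj ->] Ou y Cy yu.
  pose l0 t := projT1 (cid (Ou t)).
  have l0P t : box_ordering O (u t) (l0 t) by rewrite /l0; case: cid.
  have [s sE] : exists s : 'S_n, forall i, y i = l0 zero (s i).
    apply: same_range_perm => //; last by rewrite yu (l0P zero).2.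
    exact: box_configuration O_disj _ (l0P zero).1.
  have cl0 i : continuous (fun t => l0 t i).
    move=> t G /=; rewrite nbhsE => -[G' [oG' G't] G'G].
    have oO : open (G' `&` cell_set (O i)) by apply: openI => //; exact: cell_open.
    have ut : nbhs (u t) [set A : D | \val A `&` (G' `&` cell_set (O i)) !=set0].
      apply: open_nbhs_nbhs; split; first exact: open_meets.
      exists (l0 t i); split; last by split=> //; exact: (l0P t).1.
      by rewrite -(l0P t).2; exists i.
    apply: (@filterS _ _ (@nbhs_filter I t) _ _ _ (cu t _ ut)).
    move=> t' [x [ux [G'x Ox]]]; apply: G'G.
    by rewrite /= -(box_ordering_unique O_disj (l0P t') ux Ox).
  exists (fun t i => l0 t (s i)); last by apply/funext => i; rewrite sE.
  split; first split.
  + by apply: continuous_to_prod => i; exact: cl0.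
  + move=> t i j lij; apply: (@perm_inj _ s).
    exact: (box_configuration O_disj (l0P t).1) lij.
  + move=> t; rewrite -(l0P t).2; apply/seteqP; split=> _ [i _ <-]; first by exists (s i).
    by exists (s^-1%g i) => //; rewrite permKV.
- move=> u cu h1 h2 y Cy yu.
  have [|l l1 l0] := h1 y Cy; first by rewrite first_half0.
  have [||l' l'1 l'0] := h2 (l one).
  + exact: l1.1.2.
  + by rewrite l1.2 first_half1.
  exists (path_concat l l'); last by rewrite path_concat0.
  by rewrite -[u]concat_halves; exact: lifts_concat.
Qed.

(** Each strand is connected and the cells are disjoint, so it stays in one. *)
Lemma lift_in_box (O : 'I_n -> @cell R d X) (u : I -> D) (l : I -> M) :
  disjoint_cells O -> (forall t, box_image O (u t)) -> lifts l u ->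
  exists s : 'I_n -> 'I_n, forall t i, cell_set (O (s i)) (l t i).
Proof.
move=> O_disj Ou [[cl Cl] lu].
have inO t i : exists j, cell_set (O j) (l t i).
  have [y [Oy yu]] := Ou t.
  have : \val (u t) (l t i) by rewrite -lu; exists i.
  by rewrite -yu => -[j _ <-]; exists j.
pose s i := projT1 (cid (inO zero i)).
exists s => t i.
have C0 : cell_set (O (s i)) (l zero i) by rewrite /s; case: cid.
move: t; suff h t : cell_set (O (s i)) (l t i) by [].
apply: (@connected_locally_constant I (fun t => cell_set (O (s i)) (l t i))
  (@unit_interval_connected R) _ zero t C0).
move=> {}t; have [j Oj] := inO t i.
have cli : continuous (fun t => l t i).
  exact: (continuous_comp_fun cl (@continuous_coord n X i)).
have nj : nbhs (l t i) (cell_set (O j)).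
  by apply: open_nbhs_nbhs; split=> //; exact: cell_open.
apply: (@filterS _ _ (@nbhs_filter I t) _ _ _ (cli t _ nj)) => t' /= Oj'.
by split=> h'; [rewrite -(O_disj _ _ _ Oj' h')|rewrite -(O_disj _ _ _ Oj h')].
Qed.

Lemma lifts_in_same_box (O : 'I_n -> @cell R d X) (u u' : I -> D) (l l' : I -> M) :
  disjoint_cells O -> (forall t, box_image O (u t)) -> (forall t, box_image O (u' t)) ->
  lifts l u -> lifts l' u' -> l zero = l' zero ->
  exists s : 'I_n -> 'I_n, [/\ forall t i, cell_set (O (s i)) (l t i),
    forall t i, cell_set (O (s i)) (l' t i) &
    forall t, u t = u' t -> l t = l' t].
Proof.
move=> O_disj Ou Ou' lu lu' ll'.
have [s sl] := lift_in_box O_disj Ou lu; have [s' sl'] := lift_in_box O_disj Ou' lu'.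
have ss' : s' = s.
  by apply/funext => i; apply: (O_disj _ _ (l zero i)) => //; rewrite ll'.
rewrite {}ss' in sl'; exists s; split=> // t ut; apply/funext => i.
have [y yO] := Ou t.
rewrite (@box_ordering_unique O O_disj (u t) y (l t i) (s i)) //; last first.
  by rewrite -lu.2; exists i.
by rewrite (@box_ordering_unique O O_disj (u t) y (l' t i) (s i)) // ut -lu'.2; exists i.
Qed.

Lemma lift_unique (u : I -> D) (l l' : I -> M) : continuous u ->
  lifts l u -> lifts l' u -> l zero = l' zero -> l = l'.
Proof.
move=> cu; move: l l'.
apply: (@path_bisection R D small_image (fun u => forall l l',
  lifts l u -> lifts l' u -> l zero = l' zero -> l = l')) => // {u cu}.
- move=> u _ cu [O O_disj ->] Ou l l' lu lu' ll'.
  have [s [_ _ h]] := lifts_in_same_box O_disj Ou Ou lu lu' ll'.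
  by apply/funext => t; exact: h.
- move=> u cu h1 h2 l l' lu lu' ll'.
  have e1 : first_half l = first_half l'.
    by apply: h1; [exact: lifts_first|exact: lifts_first|rewrite !first_half0].
  rewrite -[l]concat_halves -[l']concat_halves e1; congr path_concat.
  apply: h2; [exact: lifts_second|exact: lifts_second|].
  by rewrite -!first_half1 e1.
Qed.

(** Two paths with equal monodromy: same permutation of the points and same
    homotopy classes, in [X], of the strands. *)
Definition lift_equivalent (u u' : I -> D) : Prop := u zero = u' zero /\
  forall l l', lifts l u -> lifts l' u' -> l zero = l' zero -> homotopic_in setT l l'.

Let lift_equivalent_congruence : path_congruence setT lift_equivalent.
Proof.
split.
- move=> p q _ _ [pq0 pq]; split=> // l l' lq l'p ll'.
  exact/homotopic_in_sym/pq.
- move=> p q r _ [cq _] _ [pq0 pq] [qr0 qr]; split; first by rewrite pq0.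
  move=> l l' lp l'r ll'.
  have [|m mq m0] := path_lifting (y := l zero) cq (lp.1.2 zero); first by rewrite lp.2 pq0.
  apply: (homotopic_in_trans (q := m)); first by apply: pq.
  by apply: qr => //; rewrite m0.
- move=> p p' q q' _ _ _ _ pq pq' [p0 pp'] [q0 qq']; split; first by rewrite !path_concat0.
  move=> l l' lpq lpq' ll'.
  have := lifts_first lpq; have := lifts_first lpq'.
  have := lifts_second lpq; have := lifts_second lpq'.
  rewrite !first_half_concat // !second_half_concat // => l'q' lq l'p' lp.
  have h1 : homotopic_in setT (first_half l) (first_half l').
    by apply: pp' => //; rewrite !first_half0.
  rewrite -[l]concat_halves -[l']concat_halves; apply: homotopic_in_concat => //.
    exact: first_half1.
  apply: qq' => //; rewrite -!first_half1; exact: (homotopic_in_ends h1).2.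
- move=> p phi [cp _] [cphi phi0 phi1]; split; first by rewrite /= phi0.
  move=> l l' lp l'p ll'.
  have lphi : lifts (l \o phi) (p \o phi).
    split; last by move=> t; exact: lp.2.
    by apply: path_in_reparam => //; exact: lp.1.
  have -> : l' = l \o phi.
    apply: (@lift_unique (p \o phi)) => //; last by rewrite /= phi0.
    exact: continuous_comp_fun.
  apply: homotopic_in_reparam => //; split=> //; exact: lp.1.1.
Qed.

Let lift_equivalent_good : locally_good setT lift_equivalent.
Proof.
move=> A N /small_image_nbhs[O [O_disj OA ON]].
exists (box_image O); split=> //; split.
- exact: box_image_open.
- by exists A.
- move=> A1 A2 [[y1 [O1 yA1]] _] [[y2 [O2 yA2]] _].
  have [p [cp Op p0 p1]] := box_path_connected d3 O1 O2.
  have [k ck kE] : exists2 k : I -> D, continuous k & forall z, \val (k z) = range (p z).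
    by apply: exists_config_map => // t; exact: (box_configuration O_disj).
  exists k; split.
  + by split=> // t; split=> //; exists (p t).
  + by apply: Dconf_eq; rewrite kE p0 yA1.
  + by apply: Dconf_eq; rewrite kE p1 yA2.
- move=> u u' [cu Ou] [cu' Ou'] uu0 uu1; split=> // l l' lu lu' ll'.
  have [||s [sl sl' h]] := @lifts_in_same_box O u u' l l' O_disj _ _ lu lu' ll'.
  + by move=> t; case: (Ou t).
  + by move=> t; case: (Ou' t).
  apply: (box_homotopic d3 (O := fun i => O (s i))) => //; [exact: lu.1.1|exact: lu'.1.1|exact: h].
Qed.

(** The monodromy is a homotopy invariant: inside an evenly covered set, lifts with
    a common start share their end and are homotopic in the box, so the
    invariance theorem applies to the equivalence of lifts. *)
Theorem homotopic_lifts (u u' : I -> D) (l l' : I -> M) :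
  homotopic_in setT u u' -> lifts l u -> lifts l' u' -> l zero = l' zero ->
  homotopic_in setT l l'.
Proof.
move=> h; have [Su Su'] := homotopic_in_path h.
have [_ +] := homotopic_congruent lift_equivalent_congruence lift_equivalent_good Su Su' h.
exact.
Qed.

End Covering.

(** * Monodromy and the isomorphism *)

Section PathAlgebra.
Context {R : realType} {T : topologicalType}.
Local Notation I := (unit_interval R).
Implicit Types p q a b c : I -> T.

(** The path [p] carried to other base points along [a] and [b]. *)
Definition conj_path a p b : I -> T := path_concat (path_concat a p) (path_rev b).

Lemma conj_path0 a p b : conj_path a p b zero = a zero.
Proof. by rewrite /conj_path !path_concat0. Qed.

Lemma conj_path1 a p b : conj_path a p b one = b zero.
Proof. by rewrite /conj_path path_concat1 path_rev1. Qed.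

Lemma conj_path_in S a p b : path_in S a -> path_in S p -> path_in S b ->
  a one = p zero -> p one = b one -> path_in S (conj_path a p b).
Proof.
move=> Sa Sp Sb ap pb; apply: path_in_concat.
- exact: path_in_concat.
- exact: path_in_rev.
- by rewrite path_concat1 path_rev0.
Qed.

Lemma conj_path_homotopic S a p q b : path_in S a -> path_in S b ->
  a one = p zero -> p one = b one -> homotopic_in S p q ->
  homotopic_in S (conj_path a p b) (conj_path a q b).
Proof.
move=> Sa Sb ap pb pq; apply: homotopic_in_concat.
- by rewrite path_concat1 path_rev0.
- by apply: homotopic_in_concat => //; exact: homotopic_in_refl.
- exact/homotopic_in_refl/path_in_rev.
Qed.

Lemma conj_pathK S a p b : path_in S a -> path_in S p -> path_in S b ->
  a one = p zero -> p one = b one ->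
  homotopic_in S (conj_path (path_rev a) (conj_path a p b) (path_rev b)) p.
Proof.
move=> Sa Sp Sb ap pb; rewrite {1}/conj_path path_revK.
have Sa' := path_in_rev Sa; have Sb' := path_in_rev Sb.
have Sap : path_in S (path_concat a p) by exact: path_in_concat.
have apb : path_concat a p one = path_rev b zero by rewrite path_concat1 path_rev0.
have Sc : path_in S (conj_path a p b) by exact: conj_path_in.
apply: (homotopic_in_trans (q := path_concat (path_concat p (path_rev b)) b)).
  apply: homotopic_in_concat; last exact: homotopic_in_refl.
    by rewrite path_concat1 conj_path1.
  apply: (homotopic_in_trans (q := path_concat (path_concat (path_rev a) (path_concat a p)) (path_rev b))).
    apply: homotopic_in_sym; apply: homotopic_in_assoc => //.
    by rewrite path_rev1 path_concat0.
  apply: homotopic_in_concat; last exact: homotopic_in_refl.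
    by rewrite !path_concat1 path_rev0.
  apply: (homotopic_in_trans (q := path_concat (path_concat (path_rev a) a) p)).
    by apply: homotopic_in_sym; apply: homotopic_in_assoc => //; rewrite path_rev1.
  apply: (homotopic_in_trans (q := path_concat (fun _ : I => p zero) p)).
    apply: homotopic_in_concat; [by rewrite path_concat1| |exact: homotopic_in_refl].
    by rewrite -ap; exact: homotopic_in_revl.
  exact: homotopic_in_cstl.
apply: (homotopic_in_trans (q := path_concat p (path_concat (path_rev b) b))).
  by apply: homotopic_in_assoc => //; rewrite ?path_rev0 ?path_rev1.
apply: (homotopic_in_trans (q := path_concat p (fun _ : I => p one))).
  apply: homotopic_in_concat; [by rewrite path_concat0 path_rev0|exact: homotopic_in_refl|].
  by rewrite pb; exact: homotopic_in_revl.
exact: homotopic_in_cstr.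
Qed.

Lemma conj_path_concat S a p b q c :
  path_in S a -> path_in S p -> path_in S b -> path_in S q -> path_in S c ->
  a one = p zero -> p one = b one -> b one = q zero -> q one = c one ->
  homotopic_in S (path_concat (conj_path a p b) (conj_path b q c))
    (conj_path a (path_concat p q) c).
Proof.
move=> Sa Sp Sb Sq Sc ap pb bq qc.
have Sb' := path_in_rev Sb; have Sc' := path_in_rev Sc.
have Sap : path_in S (path_concat a p) by exact: path_in_concat.
have qc' : q one = path_rev c zero by rewrite path_rev0.
have pq : p one = q zero by rewrite pb.
have Sqc : path_in S (path_concat q (path_rev c)) by exact: path_in_concat.
apply: (homotopic_in_trans (q := path_concat (conj_path a p b)
   (path_concat (path_rev (path_rev b)) (path_concat q (path_rev c))))).
  apply: homotopic_in_concat; first by rewrite conj_path1 conj_path0.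
    by apply: homotopic_in_refl; exact: conj_path_in.
  by rewrite path_revK; exact: homotopic_in_assoc.
apply: (homotopic_in_trans (q := path_concat (path_concat a p) (path_concat q (path_rev c)))).
  by apply: homotopic_in_cancel => //; rewrite ?path_concat1 ?path_concat0 ?path_rev0.
apply: (homotopic_in_trans (q := path_concat (path_concat (path_concat a p) q) (path_rev c))).
  by apply: homotopic_in_sym; apply: homotopic_in_assoc => //; rewrite path_concat1.
apply: homotopic_in_concat; [by rewrite path_concat1| |exact: homotopic_in_refl].
exact: homotopic_in_assoc.
Qed.

End PathAlgebra.

Section LoopClass.
Context {R : realType} {T : topologicalType} {x : T}.
Local Notation I := (unit_interval R).
Local Notation pi1 := (@pi1 R T x).

Definition based_loop (p : I -> T) : Prop := [/\ continuous p, p zero = x & p one = x].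

Lemma loop_based (p : loop R x) : based_loop p.
Proof. by split; [exact: cts_fun|exact: path_zero|exact: path_one]. Qed.

Lemma exists_loop (p : I -> T) : based_loop p -> exists q : loop R x, q =1 p.
Proof. by move=> [cp p0 p1]; exists (mk_path cp p0 p1). Qed.

Lemma homotopic_loopsP (p q : loop R x) : homotopic p q <-> homotopic_in setT p q.
Proof.
split=> [/asboolP[H [cH H01 Hx]]|[H [cH H01 Hx _]]].
  by exists H; split=> // s; rewrite !path_zero !path_one.
apply/asboolP; exists H; split=> // s.
by have := Hx s; rewrite !path_zero !path_one.
Qed.

(** Total on maps, with the trivial class where the map is not a loop at [x]; this
    lets classes of composite paths be written without carrying proofs. *)
Definition loop_class (p : I -> T) : pi1 :=
  if pselect (based_loop p) is left h then \pi_pi1 (projT1 (cid (exists_loop h)))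
  else pi1_one.

Lemma loop_class_loop (p : loop R x) : loop_class p = \pi_pi1 p.
Proof.
rewrite /loop_class; case: pselect => [h|]; last by case; exact: loop_based.
by case: cid => q /= /path_eqP ->.
Qed.

Lemma loop_class_eqP (p q : I -> T) : based_loop p -> based_loop q ->
  loop_class p = loop_class q <-> homotopic_in setT p q.
Proof.
move=> /exists_loop[p' /funext <-] /exists_loop[q' /funext <-].
by rewrite !loop_class_loop pi1_eqP homotopic_loopsP.
Qed.

Lemma loop_class_concat (p q : I -> T) : based_loop p -> based_loop q ->
  loop_class (path_concat p q) = pi1_mul (loop_class p) (loop_class q).
Proof.
move=> /exists_loop[p' /funext <-] /exists_loop[q' /funext <-].
by rewrite !loop_class_loop pi1_mulE -loop_class_loop.
Qed.

End LoopClass.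

Lemma homotopic_in_coord (R : realType) (n : nat) (X : topologicalType)
    (p q : unit_interval R -> prod_topology (fun _ : 'I_n => X)) :
  homotopic_in setT p q <->
  forall i, homotopic_in setT (fun t => p t i) (fun t => q t i).
Proof.
split=> [h i|h].
  by apply: (@homotopic_in_comp R _ _ setT setT
    (fun y : prod_topology (fun _ : 'I_n => X) => y i)) h => // y _;
    exact: continuous_coord.
pose H i := projT1 (cid (h i)).
have HP i : [/\ continuous (H i),
    forall t, H i (t, zero) = p t i /\ H i (t, one) = q t i,
    forall s, H i (zero, s) = p zero i /\ H i (one, s) = p one i
  & forall z, setT (H i z)] by rewrite /H; case: cid.
exists (fun z i => H i z); split=> //.
- by apply: continuous_to_prod => i; have [] := HP i.
- by move=> t; split; apply/funext => i; have [_ /(_ t)[]] := HP i.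
- by move=> s; split; apply/funext => i; have [_ _ /(_ s)[]] := HP i.
Qed.

Lemma manifold_path_connected (R : realType) (d : nat) (X : topologicalType) :
  (3 <= d)%N -> smooth_manifold R d X -> connected [set: X] ->
  forall a b : X, exists p : unit_interval R -> X,
    [/\ continuous p, p zero = a & p one = b].
Proof.
move=> d3 Xm Xc a b.
pose C (y : X) := exists p : unit_interval R -> X, [/\ continuous p, p zero = a & p one = y].
suff : C b by [].
have Ca : C a by exists (fun=> a); split=> //; exact: cst_continuous.
apply: (@connected_locally_constant X C Xc _ a b Ca) => x.
have [O [Ox _]] := exists_cell Xm (@filterT _ _ (@nbhs_filter X x)).
have joins y z : cell_set O y -> cell_set O z -> C y -> C z.
  move=> Oy Oz [p [cp p0 p1]].
  have [q [cq _ q0 q1]] := box_path_connected (n := 1) (O := fun=> O) d3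
    (a := fun=> y) (b := fun=> z) (fun=> Oy) (fun=> Oz).
  have pT : path_in setT p by [].
  have qT : path_in setT (fun t => q t ord0).
    by split=> //; exact: (continuous_comp_fun cq (@continuous_coord 1 X ord0)).
  have e : p one = q zero ord0 by rewrite p1 q0.
  exists (path_concat p (fun t => q t ord0)); split.
  - exact: (path_in_concat pT qT e).1.
  - by rewrite path_concat0.
  - by rewrite path_concat1 q1.
have nO : nbhs x (cell_set O) by apply: open_nbhs_nbhs; split=> //; exact: cell_open.
by apply: filterS nO => y Oy; split; exact: joins.
Qed.

Section Monodromy.
Context {R : realType} {d n : nat} {X : topologicalType}.
Local Notation I := (unit_interval R).
Local Notation M := (prod_topology (fun _ : 'I_n => X)).
Local Notation D := (Dconf n X).
Local Notation C := (@configurations X n).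
Variables (x : X) (c : D) (y : M) (lam : 'I_n -> I -> X).
Local Notation W := (sym_sdprod (pi1 R x) n).
Hypothesis X_manifold : smooth_manifold R d X.
Hypothesis d3 : (3 <= d)%N.
Hypothesis Cy : C y.
Hypothesis yc : range y = \val c.
Hypothesis lam_cont : forall i, continuous (lam i).
Hypothesis lam0 : forall i, lam i zero = x.
Hypothesis lam1 : forall i, lam i one = y i.

Let lamT i : path_in setT (lam i). Proof. by []. Qed.

(** The [i]-th strand runs from [y i] to [y (s i)]; the paths [lam] close it up to
    a loop at [x]. *)
Definition strand (l : I -> M) (s : 'S_n) (i : 'I_n) : I -> X :=
  conj_path (lam i) (fun t => l t i) (lam (s i)).

(** A braid is sent to the classes of its strands and to the inverse of the
    permutation of its endpoints: strand [i] of a product continues with strand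
    [s i] of the second factor, whereas the product of the semidirect product
    uses the index [a.2^-1 i]. *)
Definition monodromy (p : loop R c) (w : W) : Prop := exists l (s : 'S_n),
  [/\ lifts l p, l zero = y, forall i, l one i = y (s i) &
      w = ([ffun i => loop_class (strand l s i)], s^-1%g)].

Let coord_path (l : I -> M) i : continuous l -> path_in setT (fun t => l t i).
Proof.
by move=> cl; split=> //; exact: (continuous_comp_fun cl (@continuous_coord n X i)).
Qed.

Let strand_based (l : I -> M) (s : 'S_n) i : continuous l -> l zero = y ->
  (forall i, l one i = y (s i)) -> based_loop (x := x) (strand l s i).
Proof.
move=> cl l0 l1; split; last by rewrite /strand conj_path1.
  apply: (conj_path_in (lamT i) (coord_path i cl) (lamT (s i)) _ _).1.
    by rewrite lam1 l0.
  by rewrite lam1 l1.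
by rewrite /strand conj_path0.
Qed.

Lemma monodromy_ex (p : loop R c) : exists w, monodromy p w.
Proof.
have [cp p0 p1] := loop_based p.
have [|l lp l0] := path_lifting X_manifold cp Cy; first by rewrite yc p0.
have [s sE] : exists s : 'S_n, forall i, l one i = y (s i).
  by apply: same_range_perm => //; [exact: lp.1.2|rewrite yc lp.2 p1].
by exists ([ffun i => loop_class (strand l s i)], s^-1%g), l, s; split.
Qed.

Lemma monodromy_homotopic (p q : loop R c) w w' : homotopic p q ->
  monodromy p w -> monodromy q w' -> w = w'.
Proof.
move=> /homotopic_loopsP pq [l [s [lp l0 l1 ->]]] [m [r [mq m0 m1 ->]]].
have lm : homotopic_in setT l m.
  by apply: (homotopic_lifts X_manifold d3 pq lp mq); rewrite l0 m0.
have -> : r = s.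
  by apply/permP => i; apply: Cy; rewrite -l1 -m1 (homotopic_in_ends lm).2.
have r1 i : m one i = y (s i) by rewrite -(homotopic_in_ends lm).2.
congr (_, _); apply/ffunP => i; rewrite !ffunE.
apply/loop_class_eqP; [exact: strand_based lp.1.1 _ _|exact: strand_based mq.1.1 _ _|].
apply: conj_path_homotopic => //; first by rewrite lam1 l0.
  by rewrite lam1 l1.
exact: (iffLR (homotopic_in_coord l m) lm i).
Qed.

Lemma monodromy_concat (p q : loop R c) w w' :
  monodromy p w -> monodromy q w' -> monodromy (concat p q) (w * w')%g.
Proof.
move=> [l [s [lp l0 l1 ->]]] [m [r [mq m0 m1 ->]]].
(* The second loop has to be lifted from the end of the first lift. *)
pose ms : I -> M := fun t i => m t (s i).
have msq : lifts ms q.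
  split; first split.
  - by apply: continuous_to_prod => i; exact: (coord_path (s i) mq.1.1).1.
  - by move=> t i j /(mq.1.2 t) /perm_inj.
  - move=> t; rewrite -mq.2; apply/seteqP; split=> _ [i _ <-]; first by exists (s i).
    by exists (s^-1%g i) => //; rewrite /ms permKV.
have lms : l one = ms zero by apply/funext => i; rewrite l1 /ms m0.
exists (path_concat l ms), (s * r)%g; split.
- exact: lifts_concat.
- by rewrite path_concat0.
- by move=> i; rewrite path_concat1 /ms m1 permM.
rewrite invMg; congr (_, _); apply/ffunP => i; rewrite !ffunE invgK.
have bs := strand_based i lp.1.1 l0 l1; have bm := strand_based (s i) mq.1.1 m0 m1.
rewrite -[LHS]/(pi1_mul _ _) -loop_class_concat //.
apply/loop_class_eqP.
- have [cs s0 s1] := bs; have [cm m0' m1'] := bm.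
  have sm : strand l s i one = strand m r (s i) zero by rewrite s1 m0'.
  split; rewrite ?path_concat0 ?path_concat1 //.
  by apply: (@path_in_concat R X setT _ _ _ _ sm).1.
- apply: strand_based; last by move=> j; rewrite path_concat1 /ms m1 permM.
    exact: (path_in_concat lp.1 msq.1 lms).1.
  by rewrite path_concat0.
rewrite /strand permM (comp_concat (fun z : M => z i)).
apply: conj_path_concat => //.
- exact: coord_path lp.1.1.
- exact: coord_path mq.1.1.
- by rewrite lam1 l0.
- by rewrite lam1 l1.
- by rewrite lam1 m0.
- by rewrite lam1 m1.
Qed.

(** Equal classes give lifts homotopic strand by strand in the power of [X]; the
    homotopy is pushed off the diagonals and projected to configurations. *)
Lemma monodromy_inj (p q : loop R c) w : monodromy p w -> monodromy q w -> homotopic p q.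
Proof.
move=> [l [s [lp l0 l1 ->]]] [m [r [mq m0 m1 [wE /invg_inj rs]]]].
rewrite -{}rs in m1 wE.
have lm : homotopic_in setT l m.
  apply/homotopic_in_coord => i.
  have := congr1 (fun f : {ffun 'I_n -> pi1 R x} => f i) wE; rewrite !ffunE.
  move=> /loop_class_eqP h.
  have {}h := h (strand_based i lp.1.1 l0 l1) (strand_based i mq.1.1 m0 m1).
  have lE : lam i one = l zero i by rewrite lam1 l0.
  have mE : lam i one = m zero i by rewrite lam1 m0.
  have lE' : l one i = lam (s i) one by rewrite lam1 l1.
  have mE' : m one i = lam (s i) one by rewrite lam1 m1.
  have li := coord_path i lp.1.1; have mi := coord_path i mq.1.1.
  apply: (homotopic_in_trans (homotopic_in_sym (conj_pathK (lamT i) li (lamT (s i)) lE lE'))).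
  apply: homotopic_in_trans (conj_pathK (lamT i) mi (lamT (s i)) mE mE').
  apply: conj_path_homotopic h.
  - exact: path_in_rev.
  - exact: path_in_rev.
  - by rewrite path_rev1 /strand conj_path0.
  - by rewrite path_rev1 /strand conj_path1.
have [H [cH H01 He CH]] := homotopy_off_diagonal X_manifold d3 lp.1 mq.1 lm.
have [k ck kE] : exists2 k : I * I -> D, continuous k & forall z, \val (k z) = range (H z).
  exact: exists_config_map.
have [_ p0 p1] := loop_based p.
apply/asboolP; exists k; split=> //.
- by move=> t; split; apply: Dconf_eq; rewrite kE ?(H01 t).1 ?(H01 t).2 ?lp.2 ?mq.2.
- by move=> t; split; apply: Dconf_eq; rewrite kE ?(He t).1 ?(He t).2 lp.2 ?p0 ?p1.
Qed.

(** Prescribed strands form a path in the power of [X], which is pushed off the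
    diagonals without changing the homotopy classes of its coordinates. *)
Lemma monodromy_surj (w : W) : exists p, monodromy p w.
Proof.
case: w => al a; have [s ->] : exists s : 'S_n, a = s^-1%g by exists a^-1%g; rewrite invgK.
pose A i : loop R x := repr (al i).
have bA i := loop_based (A i).
have AT i : path_in setT (A i) by split=> //; case: (bA i).
pose g : I -> M := fun t i => conj_path (path_rev (lam i)) (A i) (path_rev (lam (s i))) t.
have gi i : path_in setT (conj_path (path_rev (lam i)) (A i) (path_rev (lam (s i)))).
  have [_ A0 A1] := bA i.
  by apply: conj_path_in; rewrite ?path_rev1 ?lam0 ?A0 ?A1 //; exact: path_in_rev.
have cg : continuous g by apply: continuous_to_prod => i; exact: (gi i).1.
have g0 : g zero = y by apply/funext => i; rewrite /g conj_path0 path_rev0 lam1.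
have g1 i : g one i = y (s i) by rewrite /g conj_path1 path_rev0 lam1.
have Cg1 : C (g one) by move=> i j; rewrite !g1 => /Cy /perm_inj.
have [|u Cu gu] := path_off_diagonal X_manifold d3 cg _ Cg1; first by rewrite g0.
have [k ck kE] := exists_config_map Cu.1 Cu.2.
have [u0 u1] := homotopic_in_ends gu; rewrite g0 in u0.
have k0 : k zero = c by apply: Dconf_eq; rewrite kE -u0.
have k1 : k one = c.
  apply: Dconf_eq; rewrite kE -u1 -yc; apply/seteqP; split=> _ [i _ <-].
    by exists (s i).
  by exists (s^-1%g i) => //; rewrite g1 permKV.
have u1' i : u one i = y (s i) by rewrite -u1.
exists (mk_path ck k0 k1), u, s; split=> //.
  by split=> // t; rewrite -kE.
congr (_, _); apply/ffunP => i; rewrite ffunE.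
rewrite -[LHS]reprK -loop_class_loop; apply/loop_class_eqP; first exact: bA.
  exact: strand_based Cu.1 _ _.
apply: homotopic_in_sym.
apply: (homotopic_in_trans (q := strand g s i)).
  apply: conj_path_homotopic => //; first by rewrite lam1 -u0.
    by rewrite lam1.
  by apply: homotopic_in_sym; exact: (iffLR (homotopic_in_coord g u) gu i).
rewrite /strand -[lam i]path_revK -[lam (s i)]path_revK.
have [_ A0 A1] := bA i.
by apply: conj_pathK => //; rewrite ?path_rev1 ?lam0 ?A0 ?A1 //; exact: path_in_rev.
Qed.

Theorem pi1_Dconf_isomorphic : group_isomorphic (pi1 R c) W.
Proof.
pose f (a : pi1 R c) : W := projT1 (cid (monodromy_ex (repr a))).
have fP a : monodromy (repr a) (f a) by rewrite /f; case: cid.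
have fM : {morph f : a b / (a * b)%g >-> (a * b)%g}.
  move=> a b; apply: (monodromy_homotopic _ (fP _) (monodromy_concat (fP a) (fP b))).
  by apply/pi1_eqP; rewrite reprK.
have finj : injective f.
  move=> a b fab; rewrite -[a]reprK -[b]reprK; apply/pi1_eqP.
  by apply: (monodromy_inj (fP a)); rewrite fab; exact: fP.
have fsurj w : exists a, f a = w.
  have [p pw] := monodromy_surj w; exists (\pi_(pi1 R c) p).
  by apply: (monodromy_homotopic _ (fP _) pw); apply/pi1_eqP; rewrite reprK.
pose g w := projT1 (cid (fsurj w)).
have gK : cancel g f by move=> w; rewrite /g; case: cid.
pose fh := isMultiplicative.Build _ _ f fM.
pose F : {multiplicative pi1 R c -> W} := HB.pack f fh.
exists F; exists g => // a; apply: finj; exact: gK.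
Qed.

End Monodromy.

Theorem theorem6p8 (R : realType) (X : topologicalType) (d n : nat)
    (X_connected : connected [set: X])
    (X_polyhedron : finite_polyhedron R X)
    (X_manifold : smooth_manifold R d X)
    (d_ge3 : (3 <= d)%N) (n_ge1 : (1 <= n)%N)
    (x : X) (c : Dconf n X) :
  group_isomorphic (pi1 R c) (sym_sdprod (pi1 R x) n).
Proof.
have [y Cy yc] := exists_ordering c.
have lam i := cid (manifold_path_connected d_ge3 X_manifold X_connected x (y i)).
apply: (@pi1_Dconf_isomorphic R d n X x c y (fun i => projT1 (lam i))) => //.
- by move=> i; case: (lam i) => p [].
- by move=> i; case: (lam i) => p [].
- by move=> i; case: (lam i) => p [].
Qed.
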